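(* The vacuum vector $\Omega$ is cyclic for the family $(\langle\omega,h\rangle)_{h\in B_0(\mathbb R_+)}$: if $\mathbf A$ denotes the real algebra of operators on $\mathcal F$ generated by the identity and all $\langle\omega,h\rangle$, $h\in B_0(\mathbb R_+)$, then $\{P\Omega\mid P\in\mathbf A\}$ is dense in $\mathcal F$. Consequently the map $P\mapsto P\Omega$ extends by continuity to a unitary operator $I:L^2(\tau)\to\mathcal F$.
   Context: Setup. Let $\nu$ be a probability measure on $\mathbb R$ with compact support, $\mathbb R_+=[0,\infty)$. For $n\in\mathbb N$ let $T_n=\{(t_1,\dots,t_n)\in\mathbb R_+^n: t_1\ge t_2\ge\dots\ge t_n\}$ and $S_n=\{(t_1,s_1,\dots,t_n,s_n)\in(\mathbb R_+\times\mathbb R)^n:(t_1,\dots,t_n)\in T_n\}$. The monotone Fock space is $\mathcal F=\bigoplus_{n\ge0}\mathcal F^{(n)}$, $\mathcal F^{(0)}=\mathbb R$, $\mathcal F^{(n)}=L^2(S_n,dt_1\,d\nu(s_1)\cdots dt_n\,d\nu(s_n))$; $\Omega=(1,0,0,\dots)$ is the vacuum and $f^{(n)}\in\mathcal F^{(n)}$ is identified with the corresponding element of $\mathcal F$. $B_0(\mathbb R_+^n)$ is the space of bounded measurable functions on $\mathbb R_+^n$ with compact support; a sequence converges in $B_0(\mathbb R_+^n)$ if all terms vanish outside a common compact set and it converges uniformly. For $h\in B_0(\mathbb R_+)$ define bounded operators on $\mathcal F$: the creation operator $a^+(h)$, $a^+(h)\Omega=h$ (the function $(t,s)\mapsto h(t)$),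 $(a^+(h)f^{(n)})(t_1,s_1,\dots,t_{n+1},s_{n+1})=h(t_1)f^{(n)}(t_2,s_2,\dots,t_{n+1},s_{n+1})$; the neutral operator $a^0(h)$, $a^0(h)\Omega=0$, $(a^0(h)f^{(n)})(t_1,s_1,\dots,t_n,s_n)=h(t_1)s_1f^{(n)}(t_1,s_1,\dots,t_n,s_n)$; the annihilation operator $a^-(h)$, $a^-(h)\Omega=0$, $(a^-(h)f^{(n)})(t_1,s_1,\dots,t_{n-1},s_{n-1})=\int_{t_1}^\infty\int_{\mathbb R}h(u)f^{(n)}(u,v,t_1,s_1,\dots,t_{n-1},s_{n-1})\,d\nu(v)\,du$ (for $n=1$: $\int_0^\infty\int_{\mathbb R}h(u)f^{(1)}(u,v)\,d\nu(v)\,du\;\Omega$). Put $\langle\omega,h\rangle=a^+(h)+a^0(h)+a^-(h)$, a bounded self-adjoint operator. For $h_1,\dots,h_n\in B_0(\mathbb R_+)$ put $\langle\omega^{\otimes n},h_1\otimes\cdots\otimes h_n\rangle=\langle\omega,h_1\rangle\cdots\langle\omega,h_n\rangle$, where $(h_1\otimes\cdots\otimes h_n)(t_1,\dots,t_n)=h_1(t_1)\cdots h_n(t_n)$; this extends by linearity and strong continuity to a map $f^{(n)}\mapsto\langle\omega^{\otimes n},f^{(n)}\rangle$ from $B_0(\mathbb R_+^n)$ to bounded operators on $\mathcal F$ (monomials of order $n$; monomials of order $0$ are real multiples of the identity). Let $\mathbf P$ be the linear span of all monomials (polynomials of $\omega$) and $\mathbf P^{(n)}$ the span of monomials of order $\le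 n$. $L^2(\tau)$ is the Hilbert space completion of $\mathbf P$ modulo null vectors with respect to $(P_1,P_2)_{L^2(\tau)}=(P_1\Omega,P_2\Omega)_{\mathcal F}$. *)

(* Defs.v *)
From mathcomp Require Import all_boot all_order all_algebra.
From mathcomp Require Import all_classical all_reals all_analysis.
Set Implicit Arguments. Unset Strict Implicit. Unset Printing Implicit Defensive.
Import Order.TTheory GRing.Theory Num.Theory.
Local Open Scope ring_scope.
Local Open Scope classical_set_scope.

(* The index set of the n-particle space: n-tuples ((t_1,s_1),...,(t_n,s_n))
   of points of R_+ x R (the tuple type carries the product sigma-algebra). *)
Section Monotone.
Variable R : realType.

Definition in_S (s : seq (R * R)) : bool :=
  sorted (fun a b : R * R => b.1 <= a.1) s && all (fun a : R * R => 0 <= a.1) s.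

Definition tfirst (s : seq (R * R)) : R := (head (0, 0) s).1.

(* elements of B_0(R_+) : bounded measurable functions with compact support in R_+
   (values at negative arguments are irrelevant) *)
Definition B0 (h : R -> R) : Prop :=
  measurable_fun setT h /\
  (exists M : R, forall t, 0 <= t -> `|h t| <= M) /\
  (exists T : R, forall t, T < t -> h t = 0).

(* Vectors: a sequence of n-particle functions f^(n) : (R_+ x R)^n -> R
   (only their values on S_n matter). *)
Definition fvec := forall n : nat, n.-tuple (R * R) -> R.

Definition vacuum : fvec := fun n _ => if n is 0 then 1 else 0.

Definition vadd (F G : fvec) : fvec := fun n x => F n x + G n x.
Definition vscale (c : R) (F : fvec) : fvec := fun n x => c * F n x.

Variable nu : probability R R.

Fixpoint iint (n : nat) : (n.-tuple (R * R) -> \bar R) -> \bar R :=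
  match n with
  | 0 => fun g => g [tuple]
  | m.+1 => fun g =>
      (\int[@lebesgue_measure R]_t \int[nu]_s
          iint (fun y : m.-tuple (R * R) => g [tuple of (t, s) :: y]))%E
  end.

Definition norm2 (n : nat) (f : n.-tuple (R * R) -> R) : \bar R :=
  iint (fun x => ((in_S x)%:R * f x ^+ 2)%:E).

Definition in_Fock (F : fvec) : Prop :=
  (forall n, measurable_fun setT (F n)) /\
  (\sum_(n <oo) norm2 (F n) < +oo)%E.

Definition dist2 (F G : fvec) : \bar R :=
  (\sum_(n <oo) norm2 (fun x => (F n x - G n x)%R))%E.

Definition acre (h : R -> R) (F : fvec) : fvec :=
  fun n => match n return n.-tuple (R * R) -> R with
           | 0 => fun _ => 0
           | m.+1 => fun x => h (thead x).1 * F m [tuple of behead x]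
           end.

Definition aneu (h : R -> R) (F : fvec) : fvec :=
  fun n => match n return n.-tuple (R * R) -> R with
           | 0 => fun _ => 0
           | m.+1 => fun x => h (thead x).1 * (thead x).2 * F m.+1 x
           end.

(* annihilation operator a^-(h): integrate u over [t_1, oo) (over [0, oo) if n = 0) *)
Definition aann (h : R -> R) (F : fvec) : fvec :=
  fun n x =>
    fine (\int[@lebesgue_measure R]_(u in [set u | (tfirst x <= u)%R])
            \int[nu]_v (h u * F n.+1 [tuple of (u, v) :: x])%:E)%E.

Definition omega (h : R -> R) (F : fvec) : fvec :=
  vadd (acre h F) (vadd (aneu h F) (aann h F)).

Inductive inA : (fvec -> fvec) -> Prop :=
  | inA_id : inA id
  | inA_omega h : B0 h -> inA (omega h)
  | inA_add P Q : inA P -> inA Q -> inA (fun F => vadd (P F) (Q F))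
  | inA_scale (c : R) P : inA P -> inA (fun F => vscale c (P F))
  | inA_mul P Q : inA P -> inA Q -> inA (fun F => P (Q F)).

End Monotone.

Definition compact_support (R : realType) (nu : probability R R) : Prop :=
  exists M : R, nu [set s | M < `|s|] = 0%E.

(* Main.v *)
Require Import Defs.
From mathcomp Require Import all_boot all_order all_algebra.
From mathcomp Require Import all_classical all_reals all_analysis.
From mathcomp Require Import measurable_realfun ring lra zify.
Import Order.TTheory GRing.Theory Num.Theory.
Import numFieldNormedType.Exports.
Local Open Scope ring_scope.
Local Open Scope classical_set_scope.
Set Implicit Arguments. Unset Strict Implicit. Unset Printing Implicit Defensive.

(** Let $h$ be the indicator of $[\alpha,\beta)$. A vector $\psi$ that vanishes as soon as its first
    time is at least $\alpha$ behaves like a vacuum for $\langle\omega,h\rangle$: by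
    [iter_omS_tensor], $\langle\omega,h\rangle^k\psi$ is $\rho_k\otimes\psi$, where
    $\rho_k=\langle\omega,h\rangle^k\Omega$ is evaluated at the particles with times at least
    $\alpha$ and $\psi$ at the others. If the interval has small length $\delta$, the one-particle
    part of $\rho_{k+1}$ is $h(t)s^k+O(\delta)$ ([rho_single]): one creation followed by $k$ neutral
    operators, while every annihilation costs a factor $\delta$.

    Cut $[\alpha,\beta)$ into small cells, apply the power $k+1$ of each cell operator to $\psi$,
    remove the multiple of $\psi$ coming from the vacuum, and add up. At a configuration with
    strictly decreasing times, which is almost every one, only the cell of $t_1$ contributes, and
    for a fine mesh all other particles lie below it. Hence the sums converge boundedly, and so in
    norm, to $1_{[\alpha,\beta)}(t_1)s_1^k\psi(t_2,s_2,\dots)$ ([cell_sum_cvg], [N2_cell_sum_cvg]).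
    Tensoring with $1_{[\alpha,\beta)}(t)s^k$ is a bounded map ([N2_tens]), so the construction
    iterates through limits ([appr_tens]), and the closure of $\mathbf A\Omega$ contains the closed
    span of all such products over decreasing intervals ([prodspan_appr]).

    The rest is measure theory. The functions whose multiplication preserves the $n$-particle part
    of this span form an algebra that is closed under bounded pointwise limits ([multiplier_lim]).
    It contains $1_{t_j<c}$ and $s_j$, and, since polynomials in a bounded mark approximate a step,
    also $1_{s_j<c}$; therefore it contains all indicators of measurable sets
    ([measurable_multset]). The span also contains the indicator of $\{t_1<a\}$ in $S_n$
    ([prodspan_base]). Multiplying it by simple functions and truncating the particle number
    approximates every vector of the Fock space ([reachable_Fock]). *)

(** * Iterated integrals over tuples and their null sets *)

Section IteratedIntegral.
Variables (R : realType) (nu : probability R R).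
Local Notation leb := (@lebesgue_measure R).

Lemma iint_ge0 n (f : n.-tuple (R * R) -> \bar R) :
  (forall x, 0 <= f x)%E -> (0 <= iint nu f)%E.
Proof.
elim: n f => [|n IHn] f f0 //=.
by apply: integral_ge0 => t _; apply: integral_ge0 => s _; apply: IHn.
Qed.

Lemma measurable_integral_prob d (T : measurableType d) (f : T * R -> \bar R) :
  measurable_fun setT f -> (forall z, 0 <= f z)%E ->
  measurable_fun setT (fun x => \int[nu]_s f (x, s))%E.
Proof. exact: (@measurable_fun_fubini_tonelli_F _ _ T R R nu). Qed.

Lemma measurable_integral_lebesgue d (T : measurableType d) (f : T * R -> \bar R) :
  measurable_fun setT f -> (forall z, 0 <= f z)%E ->
  measurable_fun setT (fun x => \int[leb]_t f (x, t))%E.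
Proof.
exact: (@measurable_fun_fubini_tonelli_F _ _ T (measurableTypeR R) R leb).
Qed.

(** The parameter space is arbitrary so that the induction can move the first point [(t, s)] into
    it. *)
Lemma measurable_iint n : forall d (T : measurableType d)
  (g : T * n.-tuple (R * R) -> \bar R), measurable_fun setT g ->
  (forall z, 0 <= g z)%E ->
  measurable_fun setT (fun z => iint nu (fun y => g (z, y))).
Proof.
elim: n => [|n IH] d T g mg g0 /=.
  apply: (measurableT_comp mg).
  exact: measurable_pair2.
pose h (w : (T * R * R) * n.-tuple (R * R)) :=
  (w.1.1.1, [tuple of (w.1.1.2, w.1.2) :: w.2]).
have mh : measurable_fun setT h.
  apply: measurable_fun_pair.
    by apply: measurableT_comp => //; apply: measurableT_comp.
  apply: measurable_cons; last by [].
  apply: measurable_fun_pair; last by apply: measurableT_comp.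
  by apply: measurableT_comp => //; apply: measurableT_comp.
have m3 : measurable_fun setT
    (fun w : T * R * R => iint nu (fun y => (g \o h) (w, y))).
  apply: IH; last by move=> z; exact: g0.
  exact: measurableT_comp.
have m2 := measurable_integral_prob m3 (fun w => iint_ge0 (fun y => g0 _)).
apply: (measurable_integral_lebesgue m2) => z.
by apply: integral_ge0 => s _; apply: iint_ge0 => y; exact: g0.
Qed.

Lemma measurable_tcons n (a : R * R) :
  measurable_fun setT (fun y : n.-tuple (R * R) => [tuple of a :: y]).
Proof.
exact: (@measurable_cons _ _ (n.-tuple (R * R))%type (R * R)%type (cst a) n id).
Qed.

Section Slices.
Variables (n : nat) (g : n.+1.-tuple (R * R) -> \bar R).
Hypotheses (mg : measurable_fun setT g) (g0 : forall x, (0 <= g x)%E).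

Lemma measurable_iint_slice :
  measurable_fun setT (fun p : R * R => iint nu (fun y => g [tuple of p :: y])).
Proof.
pose h (w : (R * R) * n.-tuple (R * R)) := [tuple of w.1 :: w.2].
have mh : measurable_fun setT h by apply: measurable_cons.
apply: (@measurable_iint n _ _ (g \o h)); last by move=> z; exact: g0.
exact: measurableT_comp.
Qed.

Lemma measurable_iint_slice_snd (t : R) : measurable_fun setT
  (fun s => iint nu (fun y => g [tuple of (t, s) :: y])).
Proof.
apply: (measurableT_comp measurable_iint_slice).
exact: measurable_pair1.
Qed.

Lemma measurable_iint_slice_fst : measurable_fun setT
  (fun t : measurableTypeR R => \int[nu]_s iint nu (fun y => g [tuple of (t, s) :: y]))%E.
Proof.
apply: (measurable_integral_prob measurable_iint_slice) => z.
exact: iint_ge0.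
Qed.

Lemma measurable_slice p :
  measurable_fun setT (fun y : n.-tuple (R * R) => g [tuple of p :: y]).
Proof. exact: (measurableT_comp mg (measurable_tcons p)). Qed.

End Slices.

Lemma iintD n (f g : n.-tuple (R * R) -> \bar R) :
  measurable_fun setT f -> measurable_fun setT g ->
  (forall x, 0 <= f x)%E -> (forall x, 0 <= g x)%E ->
  (iint nu (fun x => f x + g x) = iint nu f + iint nu g)%E.
Proof.
elim: n f g => [|n IH] f g mf mg f0 g0 //=.
rewrite -ge0_integralD//; first last.
- exact: measurable_iint_slice_fst.
- by move=> t _; apply: integral_ge0 => s _; exact: iint_ge0.
- exact: measurable_iint_slice_fst.
- by move=> t _; apply: integral_ge0 => s _; exact: iint_ge0.
apply: eq_integral => t _; rewrite -ge0_integralD//; first last.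
- exact: measurable_iint_slice_snd.
- by move=> s _; exact: iint_ge0.
- exact: measurable_iint_slice_snd.
- by move=> s _; exact: iint_ge0.
by apply: eq_integral => s _; apply: IH => //; exact: measurable_slice.
Qed.

Lemma iintZ n (f : n.-tuple (R * R) -> \bar R) (c : R) : 0 <= c ->
  measurable_fun setT f -> (forall x, 0 <= f x)%E ->
  (iint nu (fun x => c%:E * f x) = c%:E * iint nu f)%E.
Proof.
move=> c0; elim: n f => [|n IH] f mf f0 //=.
rewrite -ge0_integralZl//; first last.
- by move=> t _; apply: integral_ge0 => s _; exact: iint_ge0.
- exact: measurable_iint_slice_fst.
apply: eq_integral => t _; rewrite -ge0_integralZl//; first last.
- by move=> s _; exact: iint_ge0.
- exact: measurable_iint_slice_snd.
by apply: eq_integral => s _; apply: IH => //; exact: measurable_slice.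
Qed.

(** The almost-everywhere quantifier that matches [iint]: exceptional sets are null slice by slice,
    in the order of integration, and no product measure on tuples is involved. *)
Fixpoint iae n : (n.-tuple (R * R) -> Prop) -> Prop :=
  match n with
  | 0 => fun P => P [tuple]
  | m.+1 => fun P => {ae leb, forall t : measurableTypeR R, {ae nu, forall s,
      iae (fun y : m.-tuple (R * R) => P [tuple of ((t : R), s) :: y])}}
  end.

Lemma iaeW n (P : n.-tuple (R * R) -> Prop) : (forall x, P x) -> iae P.
Proof.
elim: n P => [|n IH] P HP //=.
by apply: aeW => t; apply: aeW => s; exact: IH.
Qed.

Lemma iae_impl n (P Q : n.-tuple (R * R) -> Prop) :
  iae (fun x => P x -> Q x) -> iae P -> iae Q.
Proof.
elim: n P Q => [|n IH] P Q /= PQ p; first exact: (PQ p).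
apply: filterS2 PQ p => t; apply: filterS2 => s; exact: IH.
Qed.

Lemma iaeS n (P Q : n.-tuple (R * R) -> Prop) :
  (forall x, P x -> Q x) -> iae P -> iae Q.
Proof. by move=> PQ; apply: iae_impl; exact: iaeW. Qed.

Lemma iae_and n (P Q : n.-tuple (R * R) -> Prop) :
  iae P -> iae Q -> iae (fun x => P x /\ Q x).
Proof. by move=> p; apply: iae_impl; apply: iaeS p. Qed.

Lemma le_iint_ae n (f g : n.-tuple (R * R) -> \bar R) :
  measurable_fun setT f -> measurable_fun setT g ->
  (forall x, 0 <= f x)%E -> (forall x, 0 <= g x)%E ->
  iae (fun x => f x <= g x)%E -> (iint nu f <= iint nu g)%E.
Proof.
elim: n f g => [|n IH] f g mf mg f0 g0 /= fg //.
apply: ae_ge0_le_integral => //.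
- by move=> t _; apply: integral_ge0 => s _; exact: iint_ge0.
- exact: measurable_iint_slice_fst.
- by move=> t _; apply: integral_ge0 => s _; exact: iint_ge0.
- exact: measurable_iint_slice_fst.
apply: filterS fg => t fgt _.
apply: ae_ge0_le_integral => //.
- by move=> s _; exact: iint_ge0.
- exact: measurable_iint_slice_snd.
- by move=> s _; exact: iint_ge0.
- exact: measurable_iint_slice_snd.
by apply: filterS fgt => s fgs _; apply: IH => //; exact: measurable_slice.
Qed.

(** Each induction step uses dominated convergence twice, for [nu] on a slice of fixed time and then
    for Lebesgue measure, with the partial integrals of [G] as dominating functions. *)
Lemma iint_dominated_cvg0 n (g : nat -> n.-tuple (R * R) -> \bar R)
    (G : n.-tuple (R * R) -> \bar R) :
  (forall N, measurable_fun setT (g N)) -> measurable_fun setT G ->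
  (forall N x, 0 <= g N x)%E -> (forall x, 0 <= G x)%E ->
  iae (fun x => (forall N, g N x <= G x)%E) ->
  iae (fun x => (g N x @[N --> \oo] --> 0)%E) ->
  (iint nu G < +oo)%E ->
  (iint nu (g N) @[N --> \oo] --> 0)%E.
Proof.
elim: n g G => [|n IH] g G mg mG g0 G0 /= gG gcv iG //.
have mnn (f : n.+1.-tuple (R * R) -> \bar R) : (forall x, 0 <= f x)%E -> forall t,
    (0 <= \int[nu]_s iint nu (fun y => f [tuple of (t, s) :: y]))%E.
  by move=> f0 t; apply: integral_ge0 => s _; exact: iint_ge0.
have iG1 : leb.-integrable setT
    (fun t : measurableTypeR R => \int[nu]_s iint nu (fun y => G [tuple of (t, s) :: y]))%E.
  apply/integrableP; split; first exact: measurable_iint_slice_fst.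
  under eq_integral do rewrite gee0_abs ?mnn//.
  exact: iG.
have gN0 : {ae leb, forall t : measurableTypeR R, setT t ->
    (\int[nu]_s iint nu (fun y => g N [tuple of ((t : R), s) :: y]) @[N --> \oo]
      --> cst 0 t)%E}.
  (* Finiteness of the full integral of [G] only makes its slices integrable for almost every [t];
     the slice argument runs on that set. *)
  have /= aefin := integrable_ae measurableT iG1.
  apply: filterS3 gG gcv aefin => t gGt gct fint _.
  have iG2 : nu.-integrable setT (fun s => iint nu (fun y => G [tuple of ((t : R), s) :: y])).
    apply/integrableP; split; first exact: measurable_iint_slice_snd.
    under eq_integral do rewrite gee0_abs ?iint_ge0//.
    by rewrite -ge0_fin_numE ?mnn// fint.
  have gtN0 : {ae nu, forall s, setT s ->
      (iint nu (fun y => g N [tuple of ((t : R), s) :: y]) @[N --> \oo] --> cst 0 s)%E}.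
    have /= aefin := integrable_ae measurableT iG2.
    apply: filterS3 gGt gct aefin => s gGs gcs fins _.
    apply: (IH _ (fun y => G [tuple of ((t : R), s) :: y])) => //.
    - by move=> N; exact: measurable_slice.
    - exact: measurable_slice.
    - by rewrite -ge0_fin_numE ?iint_ge0// fins.
  have gtG : {ae nu, forall s N, setT s ->
      (`|iint nu (fun y => g N [tuple of ((t : R), s) :: y])| <=
       iint nu (fun y => G [tuple of ((t : R), s) :: y]))%E}.
    apply: filterS gGt => s gGs N _.
    rewrite gee0_abs ?iint_ge0//; apply: le_iint_ae => //.
    - exact: measurable_slice.
    - exact: measurable_slice.
    - by apply: iaeS gGs => y; exact.
  have [_ _] := dominated_convergence measurableT
    (fun N => measurable_iint_slice_snd (mg N) (g0 N) t) (measurable_cst _)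
    gtN0 iG2 gtG.
  by rewrite integral0.
have gGN : {ae leb, forall (t : measurableTypeR R) N, setT t ->
    (`|\int[nu]_s iint nu (fun y => g N [tuple of ((t : R), s) :: y])| <=
     \int[nu]_s iint nu (fun y => G [tuple of ((t : R), s) :: y]))%E}.
  apply: filterS gG => t gGt N _.
  rewrite gee0_abs ?mnn//.
  apply: ae_ge0_le_integral => //.
  - by move=> s _; exact: iint_ge0.
  - exact: measurable_iint_slice_snd.
  - by move=> s _; exact: iint_ge0.
  - exact: measurable_iint_slice_snd.
  apply: filterS gGt => s gGs _; apply: le_iint_ae => //.
  - exact: measurable_slice.
  - exact: measurable_slice.
  - by apply: iaeS gGs => y; exact.
have [_ _] := dominated_convergence measurableT
  (fun N => measurable_iint_slice_fst (mg N) (g0 N)) (measurable_cst _)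
  gN0 iG1 gGN.
by rewrite integral0.
Qed.

Lemma ae_norm_le M : nu [set s | M < `|s|] = 0%E -> {ae nu, forall s, `|s| <= M}.
Proof.
move=> nuM; exists [set s | M < `|s|]; split => //.
  rewrite [X in measurable X](_ : _ = (fun s : R => `|s|) @^-1` `]M, +oo[).
    rewrite -[X in measurable X]setTI.
    exact: (@normr_measurable R setT measurableT _ (measurable_itv _)).
  by apply/seteqP; split => s /=; rewrite in_itv/= andbT.
by move=> s /= /negP; rewrite -ltNge.
Qed.

Lemma iae_all_snd_le M n : nu [set s | M < `|s|] = 0%E ->
  iae (fun x : n.-tuple (R * R) => all (fun p => `|p.2| <= M) x).
Proof.
move=> nuM; elim: n => [|n IH] //=.
apply: aeW => t; apply: filterS (ae_norm_le nuM) => s sM.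
by apply: iaeS IH => y /= yM; rewrite sM.
Qed.

(** Once the first time is fixed, a tie forces the next time to be one prescribed value, which is
    Lebesgue-null. Strictness is what later separates the second particle from the cell of the
    first. *)
Lemma iae_sorted_lt n : iae (fun x : n.-tuple (R * R) =>
  in_S x -> sorted (fun a b : R * R => b.1 < a.1) x).
Proof.
have iae_head t m : iae (fun x : m.-tuple (R * R) =>
    if val x is p :: _ then p.1 != t else true).
  case: m => [|m] //=.
  have nt : {ae leb, forall t' : measurableTypeR R, (t' : R) != t}.
    exists [set t]; split => //; first exact: lebesgue_measure_set1.
    by move=> s /= /negP; rewrite negbK => /eqP.
  by apply: filterS nt => t' t't; apply: aeW => s; exact: iaeW.
elim: n => [|n IH] //=.
apply: aeW => t; apply: aeW => s.
apply: iae_impl (iae_and IH (iae_head t n)); apply: iaeW => y [].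
rewrite /in_S /=; case: (val y) => [|p y'] //= IHy pt.
move=> /andP[/andP[pt' y'S] /and3P[t0 p0 y'0]].
by rewrite IHy ?y'S ?p0 ?y'0 // andbT lt_neqAle pt pt'.
Qed.

End IteratedIntegral.

(** * Vectors as functions of finite sequences, and their measurability *)

Section SequenceVectors.
Variable R : realType.
Implicit Types phi psi : seq (R * R) -> R.

(* A vector is described by one function of the (untruncated) sequence of points. *)
Definition fvec_of phi : fvec R := fun n x => phi x.

Definition seq_of (F : fvec R) : seq (R * R) -> R := fun s => F (size s) (in_tuple s).

Lemma fvec_ofK F : fvec_of (seq_of F) = F.
Proof.
have FE n (x : n.-tuple (R * R)) : F (size x) (in_tuple x) = F n x.
  case: x => s sn /=; move: (sn); rewrite -(eqP sn) => sn'.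
  by congr (F _ _); apply: val_inj.
exact: functional_extensionality_dep (fun n => functional_extensionality_dep (FE n)).
Qed.

Definition mseq d (T : measurableType d) (phi : seq (R * R) -> T) : Prop :=
  forall n, measurable_fun setT (fun x : n.-tuple (R * R) => phi x).

Lemma mseq_cst d (T : measurableType d) (c : T) : mseq (fun=> c).
Proof. by move=> n; exact: measurable_cst. Qed.

Lemma mseqD phi psi : mseq phi -> mseq psi -> mseq (fun x => phi x + psi x).
Proof. by move=> f g n; exact: (measurable_funD (f n) (g n)). Qed.

Lemma mseqB phi psi : mseq phi -> mseq psi -> mseq (fun x => phi x - psi x).
Proof. by move=> f g n; exact: (measurable_funB (f n) (g n)). Qed.

Lemma mseqM phi psi : mseq phi -> mseq psi -> mseq (fun x => phi x * psi x).
Proof. by move=> f g n; exact: (measurable_funM (f n) (g n)). Qed.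

Lemma mseqZ c phi : mseq phi -> mseq (fun x => c * phi x).
Proof. by move=> f; apply: mseqM => //; exact: mseq_cst. Qed.

Lemma mseq_sum (I : Type) (r : seq I) (phi : I -> seq (R * R) -> R) :
  (forall i, mseq (phi i)) -> mseq (fun x => \sum_(i <- r) phi i x).
Proof. by move=> f n; apply: measurable_sum => i; exact: (f i n). Qed.

Lemma mseq_natr (b : seq (R * R) -> bool) : mseq b -> mseq (fun x => (b x)%:R : R).
Proof.
move=> mb n; rewrite (_ : (fun _ => _) =
    fun x : n.-tuple (R * R) => if b x then 1 else 0 : R); last first.
  by apply/funext => x; case: (b x).
by apply: measurable_fun_ifT => //; exact: mb.
Qed.

Lemma measurable_thead n :
  measurable_fun setT (fun x : n.+1.-tuple (R * R) => thead x).
Proof. exact: measurable_tnth. Qed.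

Lemma measurable_comp_snd d (T : measurableType d) n (f : n.-tuple (R * R) -> T) :
  measurable_fun setT f ->
  measurable_fun setT (fun w : (R * R) * n.-tuple (R * R) => f w.2).
Proof.
move=> mf; apply: (measurableT_comp mf).
exact: (@measurable_snd _ _ (R * R)%type (n.-tuple (R * R))%type).
Qed.

Lemma measurable_comp_fst d (T : measurableType d) n (f : R * R -> T) :
  measurable_fun setT f ->
  measurable_fun setT (fun w : (R * R) * n.-tuple (R * R) => f w.1).
Proof.
move=> mf; apply: (measurableT_comp mf).
exact: (@measurable_fst _ _ (R * R)%type (n.-tuple (R * R))%type).
Qed.

Lemma mseq_ind d (T : measurableType d) (phi : seq (R * R) -> T) :
  (forall n, measurable_fun setT (fun x : n.-tuple (R * R) => phi x) ->
    measurable_fun setT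
      (fun w : (R * R) * n.-tuple (R * R) => phi (w.1 :: w.2))) ->
  mseq phi.
Proof.
move=> mphi; elim=> [|n IH].
  rewrite (_ : (fun _ => _) = cst (phi [::])); first exact: measurable_cst.
  by apply/funext => x; rewrite tuple0.
have mh : measurable_fun setT
    (fun x : n.+1.-tuple (R * R) => (thead x, [tuple of behead x])).
  by apply: measurable_fun_pair; [exact: measurable_thead|exact: measurable_behead].
have -> : (fun x : n.+1.-tuple (R * R) => phi x) =
   (fun w : (R * R) * n.-tuple (R * R) => phi (w.1 :: w.2)) \o
   (fun x : n.+1.-tuple (R * R) => (thead x, [tuple of behead x])).
  by apply/funext => x /=; case/tupleP: x => p y; rewrite theadE.
exact: (measurableT_comp (mphi n IH) mh).
Qed.

Lemma mseq_consP d (T : measurableType d) (phi : seq (R * R) -> T) :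
  mseq phi <-> forall n, measurable_fun setT
    (fun w : (R * R) * n.-tuple (R * R) => phi (w.1 :: w.2)).
Proof.
split=> [mphi n|mphi]; last by apply: mseq_ind => n _; exact: mphi.
have mh : measurable_fun setT
    (fun w : (R * R) * n.-tuple (R * R) => [tuple of w.1 :: w.2]).
  exact: measurable_cons.
exact: (measurableT_comp (mphi n.+1) mh).
Qed.

Lemma mseq_all (a : pred (R * R)) : measurable_fun setT a -> mseq (all a).
Proof.
move=> ma; apply: mseq_ind => n mall /=.
exact: measurable_and (measurable_comp_fst ma) (measurable_comp_snd mall).
Qed.

Lemma mseq_nth i : mseq (fun x => nth (0, 0) x i : R * R).
Proof.
elim: i => [|i IH]; apply/mseq_consP => n /=; first exact: measurable_fst.
exact: (measurableT_comp (IH n)).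
Qed.

Lemma mseq_tfirst : mseq (@tfirst R).
Proof.
apply/mseq_consP => n; rewrite /tfirst /=.
by apply: measurableT_comp.
Qed.

(** The default time 0 of [tfirst] on the empty sequence turns the sign condition on a single point
    into the same comparison as for longer sequences, which makes inductions on the head uniform. *)
Lemma in_S_cons (p : R * R) y : in_S (p :: y) = (tfirst y <= p.1) && in_S y.
Proof.
rewrite /in_S /tfirst; case: y => [|q y] /=; first by rewrite andbT.
apply/idP/idP => [/andP[/andP[-> ->] /and3P[_ -> ->]] //|].
move=> /and3P[qp -> /andP[q0 ->]]; rewrite qp q0 !andbT /=.
exact: le_trans q0 qp.
Qed.

Lemma in_S_tfirst (x : seq (R * R)) : in_S x -> 0 <= tfirst x.
Proof. by rewrite /in_S /tfirst; case: x => [|p x] //= /and3P[]. Qed.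

Lemma mseq_in_S : mseq (@in_S R).
Proof.
apply: mseq_ind => n mS.
rewrite (_ : (fun _ => _) = fun w : (R * R) * n.-tuple (R * R) =>
    (tfirst w.2 <= w.1.1) && in_S w.2); last first.
  by apply/funext => w; rewrite in_S_cons.
apply: measurable_and; last exact: measurable_comp_snd mS.
apply: measurable_fun_ler; first exact: measurable_comp_snd (mseq_tfirst (n := n)).
exact: measurable_comp_fst.
Qed.

End SequenceVectors.

(** * The squared Fock norm and dominated convergence for it *)

Section SequenceNorm.
Variables (R : realType) (nu : probability R R).
Implicit Types phi psi chi : seq (R * R) -> R.
Local Notation leb := (@lebesgue_measure R).

Definition N2 phi : \bar R :=
  (\sum_(n <oo) norm2 nu (fun x : n.-tuple (R * R) => phi x))%E.

Lemma measurable_norm2_integrand n phi : mseq phi ->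
  measurable_fun setT
    (fun x : n.-tuple (R * R) => ((in_S x)%:R * phi x ^+ 2)%:E).
Proof.
move=> mphi; apply/measurable_EFinP; apply: measurable_funM.
  exact: (mseq_natr (@mseq_in_S R)).
exact: measurable_funX (mphi n).
Qed.

Lemma norm2_integrand_ge0 (b : bool) (r : R) : (0 <= (b%:R * r ^+ 2)%:E)%E.
Proof. by rewrite lee_fin mulr_ge0 ?ler0n ?sqr_ge0. Qed.

Lemma norm2_ge0 n (f : n.-tuple (R * R) -> R) : (0 <= norm2 nu f)%E.
Proof. by apply: iint_ge0 => x; exact: norm2_integrand_ge0. Qed.

Lemma N2_ge0 phi : (0 <= N2 phi)%E.
Proof. by apply: nneseries_ge0 => n _ _; exact: norm2_ge0. Qed.

Lemma N2_congr phi psi : (forall x, in_S x -> phi x = psi x) -> N2 phi = N2 psi.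
Proof.
move=> e; apply: eq_eseriesr => n _; congr iint; apply/funext => x.
by case: (boolP (in_S x)) => [/e ->|_] //; rewrite !mul0r.
Qed.

Lemma N2_sub phi psi : N2 (fun x => phi x - psi x) = N2 (fun x => psi x - phi x).
Proof.
by apply: eq_eseriesr => n _; congr iint; apply/funext => x; rewrite -sqrrN opprB.
Qed.

Lemma norm2_eq0 n phi : (forall x, size x = n -> in_S x -> phi x = 0) ->
  norm2 nu (fun x : n.-tuple (R * R) => phi x) = 0%E.
Proof.
move=> p0; rewrite /norm2.
have <- : (iint nu (fun x : n.-tuple (R * R) => 0%E) = 0)%E.
  elim: n {p0} => [|n IH] //=.
  by apply: integral0_eq => t _; apply: integral0_eq => s _; exact: IH.
congr iint; apply/funext => x; case: (boolP (in_S x)) => [xS|_].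
  by rewrite p0 ?size_tuple// expr0n mulr0.
by rewrite mul0r.
Qed.

Lemma norm2_le_N2 n phi :
  (norm2 nu (fun x : n.-tuple (R * R) => phi x) <= N2 phi)%E.
Proof.
apply: le_trans (nneseries_lim_ge n.+1 _); last by move=> i _ _; exact: norm2_ge0.
rewrite big_nat_recr//= -[leLHS]add0e leeD2r//.
by apply: sume_ge0 => i _; exact: norm2_ge0.
Qed.

(** Pointwise $2a^2+2b^2-(a+b)^2=(a-b)^2$. This replaces Minkowski's inequality: it holds for
    infinite norms too, and the factor 2 is harmless for density. *)
Lemma N2D phi psi : mseq phi -> mseq psi ->
  (N2 (fun x => (phi x + psi x)%R) <= 2%:E * N2 phi + 2%:E * N2 psi)%E.
Proof.
move=> mf mg; rewrite /N2.
rewrite -!nneseriesZl; try by move=> i _; exact: norm2_ge0.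
rewrite -nneseriesD; try by move=> i _ _; apply: mule_ge0; [|exact: norm2_ge0].
apply: lee_nneseries => [i _ _|n _].
  exact: norm2_ge0.
rewrite /norm2 -!iintZ//; try exact: measurable_norm2_integrand;
  try by move=> x; exact: norm2_integrand_ge0.
have m2 phi' : mseq phi' -> measurable_fun setT (fun x : n.-tuple (R * R) =>
    (2%:E * ((in_S x)%:R * phi' x ^+ 2)%:E)%E).
  by move=> m; apply: measurable_funeM; exact: measurable_norm2_integrand.
have p2 phi' (x : seq (R * R)) : (0 <= 2%:E * ((in_S x)%:R * phi' x ^+ 2)%:E)%E.
  by rewrite mule_ge0 ?norm2_integrand_ge0.
rewrite -iintD //; try exact: m2.
apply: le_iint_ae => //.
- exact: (@measurable_norm2_integrand n (fun x => phi x + psi x) (mseqD mf mg)).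
- by apply: emeasurable_funD; exact: m2.
- by move=> x; exact: norm2_integrand_ge0.
- by move=> x; rewrite adde_ge0.
apply: iaeW => x; rewrite -!EFinM -EFinD lee_fin.
case: (in_S x); rewrite ?mul0r ?mulr0 ?addr0 // !mul1r -subr_ge0.
rewrite [leRHS](_ : _ = (phi x - psi x) ^+ 2) ?sqr_ge0//; ring.
Qed.

Lemma N2Z c phi : mseq phi -> N2 (fun x => c * phi x) = ((c ^+ 2)%:E * N2 phi)%E.
Proof.
move=> mf; rewrite /N2 -nneseriesZl; last by move=> i _; exact: norm2_ge0.
apply: eq_eseriesr => n _; rewrite /norm2 -iintZ ?sqr_ge0//; first last.
- by move=> x; exact: norm2_integrand_ge0.
- exact: measurable_norm2_integrand.
by congr iint; apply/funext => x; rewrite -EFinM exprMn mulrCA.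
Qed.

Lemma N2_triangle phi psi chi : mseq phi -> mseq psi -> mseq chi ->
  (N2 (fun x => (phi x - chi x)%R) <=
   2%:E * N2 (fun x => (phi x - psi x)%R) + 2%:E * N2 (fun x => (psi x - chi x)%R))%E.
Proof.
move=> m1 m2 m3; apply: le_trans (N2D (mseqB m1 m2) (mseqB m2 m3)).
rewrite [X in (N2 X <= _)%E](_ : _ =
  (fun x => phi x - psi x + (psi x - chi x)))//.
by apply/funext => x; rewrite subrKA.
Qed.

Lemma N20 phi : (forall x, in_S x -> phi x = 0) -> N2 phi = 0%E.
Proof.
by move=> p0; apply: eseries0 => n _ _; apply: norm2_eq0 => x _; exact: p0.
Qed.

Section Bounded.
Variable M : R.
Hypothesis nuM : nu [set s | M < `|s|] = 0%E.

(** The essential domain: marks outside $[-M,M]$ have probability zero, so pointwise estimates are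
    only asked for here. *)
Definition inBox (x : seq (R * R)) : bool := in_S x && all (fun p => `|p.2| <= M) x.

Lemma le_N2 c phi psi : mseq phi -> mseq psi ->
  (forall x, inBox x -> `|phi x| <= c * `|psi x|) ->
  (N2 phi <= (c ^+ 2)%:E * N2 psi)%E.
Proof.
move=> mf mg fg; rewrite -N2Z//.
apply: lee_nneseries => [i _ _|n _]; first exact: norm2_ge0.
apply: le_iint_ae.
- exact: measurable_norm2_integrand.
- exact: (@measurable_norm2_integrand n (fun x => c * psi x) (mseqZ c mg)).
- by move=> x; exact: norm2_integrand_ge0.
- by move=> x; exact: norm2_integrand_ge0.
apply: iaeS (iae_all_snd_le n nuM) => x xM; rewrite lee_fin.
case: (boolP (in_S x)) => [xS|_]; last by rewrite !mul0r.
rewrite !mul1r -[leLHS]real_normK ?num_real// -[leRHS]real_normK ?num_real//.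
rewrite lerXn2r ?nnegrE//.
have /fg : inBox x by rewrite /inBox xS.
move=> h; apply: (le_trans h); rewrite normrM ler_wpM2r ?ler_norm//.
Qed.

Lemma norm2_eq0_box n phi : mseq phi ->
  (forall x, size x = n -> inBox x -> phi x = 0) ->
  norm2 nu (fun x : n.-tuple (R * R) => phi x) = 0%E.
Proof.
move=> mphi p0; apply: le_anti; rewrite norm2_ge0 andbT.
rewrite -[leRHS](@norm2_eq0 n (fun=> 0))//; apply: le_iint_ae.
- exact: measurable_norm2_integrand.
- by apply: (@measurable_norm2_integrand n (fun=> 0)); exact: mseq_cst.
- by move=> x; exact: norm2_integrand_ge0.
- by move=> x; exact: norm2_integrand_ge0.
apply: iaeS (iae_all_snd_le n nuM) => x xM; rewrite lee_fin.
case: (boolP (in_S x)) => [xS|_]; last by rewrite !mul0r.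
by rewrite p0 ?size_tuple// /inBox xS.
Qed.

Lemma N2_size phi n0 : mseq phi ->
  (forall x, inBox x -> (n0 < size x)%N -> phi x = 0) ->
  N2 phi = (\sum_(n < n0.+1) norm2 nu (fun x : n.-tuple (R * R) => phi x))%E.
Proof.
move=> mphi p0; rewrite /N2 (nneseries_split 0 n0.+1); last by move=> k _; exact: norm2_ge0.
rewrite add0n [X in (_ + X)%E]eseries0 ?adde0 ?big_mkord// => n n0n _.
by apply: norm2_eq0_box => // x xn xS; rewrite p0// xn.
Qed.

(** The common bound [n0] on the particle number reduces the series to a finite sum, and each sector
    is dominated by [G]. Ties being null, pointwise convergence is only needed at strictly
    decreasing times. *)
Lemma N2_dominated_cvg0 (g : nat -> seq (R * R) -> R)
    (G : seq (R * R) -> R) (n0 : nat) :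
  (forall N, mseq (g N)) -> mseq G ->
  (forall N x, inBox x -> `|g N x| <= `|G x|) ->
  (forall x, inBox x -> sorted (fun a b : R * R => b.1 < a.1) x ->
     g N x @[N --> \oo] --> 0) ->
  (N2 G < +oo)%E ->
  (forall N x, inBox x -> (n0 < size x)%N -> g N x = 0) ->
  (N2 (g N) @[N --> \oo] --> 0)%E.
Proof.
move=> mg mG gG gc G2 gs.
suff : (N2 (g N) @[N --> \oo] --> \sum_(n < n0.+1) (0 : \bar R))%E by rewrite big1.
under eq_cvg do rewrite (N2_size (mg _) (gs _)).
pose f (n : 'I_n0.+1) N := norm2 nu (fun x : n.-tuple (R * R) => g N x).
have f0 n : xpredT n -> \forall N \near \oo, (0 <= f n N)%E.
  by move=> _; apply: nearW => N; exact: norm2_ge0.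
suff fc n : xpredT n -> (f n N @[N --> \oo] --> 0)%E.
  exact: (cvg_nnesum f0 fc).
move=> _; rename n into i.
apply: (@iint_dominated_cvg0 R nu i _ (fun x => ((in_S x)%:R * G x ^+ 2)%:E)).
- by move=> N; exact: measurable_norm2_integrand.
- exact: measurable_norm2_integrand.
- by move=> N x; exact: norm2_integrand_ge0.
- by move=> x; exact: norm2_integrand_ge0.
- apply: iaeS (iae_all_snd_le i nuM) => x xM N; rewrite lee_fin.
  case: (boolP (in_S x)) => [xS|_]; last by rewrite !mul0r.
  rewrite !mul1r -[leLHS]real_normK ?num_real// -[leRHS]real_normK ?num_real//.
  by rewrite lerXn2r ?nnegrE// gG// /inBox xS.
- apply: iaeS (iae_and (iae_all_snd_le i nuM) (iae_sorted_lt nu i)) => x [xM xs].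
  apply: cvg_EFin; first by apply: nearW.
  rewrite (_ : fine \o _ = (fun N => (in_S x)%:R * (g N x * g N x)))//.
  case: (boolP (in_S x)) => [xS|_]; last first.
    rewrite (_ : (fun _ => _) = cst 0); first exact: cvg_cst.
    by apply/funext => N; rewrite mul0r.
  have := gc x; rewrite /inBox xS => /(_ xM (xs xS)) gx.
  rewrite (_ : 0 = 1 * (0 * 0)); last by rewrite !mulr0.
  by apply: cvgM; [exact: cvg_cst|exact: cvgM].
- exact: le_lt_trans (norm2_le_N2 i G) G2.
Qed.

(** Each point contributes the Lebesgue measure of $[0,T]$ times the total mass one of [nu]. *)
Lemma iint_box_lty (T : R) n :
  (iint nu (fun x : n.-tuple (R * R) =>
     ((all (fun p => 0 <= p.1 <= T) x)%:R : R)%:E) < +oo)%E.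
Proof.
pose b (t : R) : bool := 0 <= t <= T.
have mall : mseq (all (fun p : R * R => b p.1)).
  by apply: mseq_all; apply: measurable_and; apply: measurable_fun_ler.
elim: n => [|n IH] /=; first exact: ltry.
have mn : measurable_fun setT
    (fun x : n.-tuple (R * R) => ((all (fun p => b p.1) x)%:R : R)%:E).
  by apply/measurable_EFinP; exact: (mseq_natr mall).
set K := iint _ _ in IH.
have K0 : (0 <= K)%E by apply: iint_ge0 => x; rewrite lee_fin ler0n.
rewrite (_ : integral _ _ _ =
    \int[leb]_t (K * (\1_(`[0, T] : set R) (t : R))%:E))%E; last first.
  apply: eq_integral => t _.
  rewrite (_ : (fun s => _) = cst (K * (\1_(`[0, T] : set R) (t : R))%:E)%E).
    rewrite integral_cst//= [X in (_ * X)%E](_ : _ = 1%E) ?mule1//.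
    exact: probability_setT.
  apply/funext => s /=.
  rewrite indicE (_ : (t \in _) = b t); last first.
    by apply/idP/idP; rewrite inE /= in_itv.
  rewrite muleC -iintZ ?ler0n//.
  congr iint; apply/funext => x; rewrite -EFinM -natrM mulnb.
  by [].
have mi : measurable_fun setT (fun t : R => (\1_(`[0, T] : set R) t : R)%:E).
  by apply/measurable_EFinP; exact: measurable_indic.
rewrite ge0_integralZl//.
have -> : (\int[leb]_t (\1_(`[0, T] : set R) (t : R))%:E = leb `[0%R, T%R])%E.
  by rewrite integral_indic//= ?setIT//; exact: (measurable_itv `[0, T]).
have : (leb `[0%R, T%R] < +oo)%E.
  by rewrite lebesgue_measure_itv /=; case: ifP => _; rewrite ltry.
by move=> l; apply: lte_mul_pinfty => //; rewrite ge0_fin_numE.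
Qed.

Lemma in_S_all_le (x : seq (R * R)) T : in_S x -> tfirst x <= T ->
  all (fun p => 0 <= p.1 <= T) x.
Proof.
elim: x => [|p x IH] //; rewrite in_S_cons /= => /andP[xp xS] pT.
rewrite {1}/tfirst /= in pT; rewrite pT andbT (le_trans (in_S_tfirst xS) xp) /=.
by apply: IH => //; exact: le_trans pT.
Qed.

(** Times decrease, so a bound on the first one confines all of them to $[0,T]$; in finitely many
    sectors the norm is then at most that of a constant on a box. *)
Lemma N2_bounded_lty phi C T n0 : mseq phi ->
  (forall x, inBox x -> `|phi x| <= C) ->
  (forall x, inBox x -> T < tfirst x -> phi x = 0) ->
  (forall x, inBox x -> (n0 < size x)%N -> phi x = 0) -> (N2 phi < +oo)%E.
Proof.
move=> mphi phiC phiT phin.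
rewrite (N2_size mphi phin); apply: lte_sum_pinfty => n _.
have mb : mseq (all (fun p : R * R => 0 <= p.1 <= T)).
  by apply: mseq_all; apply: measurable_and; apply: measurable_fun_ler.
have mn : measurable_fun setT (fun x : n.-tuple (R * R) =>
    ((all (fun p => 0 <= p.1 <= T) x)%:R : R)%:E).
  by apply/measurable_EFinP; exact: (mseq_natr mb).
apply: (@le_lt_trans _ _ ((C ^+ 2)%:E * iint nu (fun x : n.-tuple (R * R) =>
    ((all (fun p => 0 <= p.1 <= T) x)%:R : R)%:E))%E); last first.
  rewrite lte_mul_pinfty// ?lee_fin ?sqr_ge0// ?iint_box_lty//.
rewrite -iintZ ?sqr_ge0//.
apply: le_iint_ae.
- exact: measurable_norm2_integrand.
- exact: measurable_funeM.
- by move=> x; exact: norm2_integrand_ge0.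
- by move=> x; rewrite -EFinM lee_fin mulr_ge0 ?sqr_ge0.
apply: iaeS (iae_all_snd_le n nuM) => x xM; rewrite -EFinM lee_fin.
case: (boolP (in_S x)) => [xS|_]; last by rewrite mul0r mulr_ge0 ?sqr_ge0.
have xB : inBox x by rewrite /inBox xS.
have [Tx|xT] := ltP T (tfirst x).
  by rewrite phiT// expr0n mulr0 mulr_ge0 ?sqr_ge0.
rewrite in_S_all_le// mul1r mulr1 -real_normK ?num_real//.
have := phiC x; rewrite /inBox xS => /(_ xM) h.
by rewrite lerXn2r ?nnegrE// (le_trans _ h).
Qed.

End Bounded.
End SequenceNorm.

(** * The field operator on sequence functions and its annihilation integral *)

Section Operators.
Variables (R : realType) (nu : probability R R).
Implicit Types phi psi : seq (R * R) -> R.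
Local Notation leb := (@lebesgue_measure R).

Definition dint (f : R * R -> R) : R :=
  fine (\int[leb]_u \int[nu]_v (f ((u : R), v))%:E)%E.

(** The operator [omega] transported to functions of sequences: creation, neutral and annihilation
    parts. The domain $u\ge t_1$ of the annihilation integral is an indicator factor, and [tfirst
    [::] = 0] yields the domain $[0,\infty)$ on the vacuum sector. *)
Definition omS (h : R -> R) phi : seq (R * R) -> R := fun x =>
  match x with
  | [::] => 0
  | p :: y => h p.1 * phi y + h p.1 * p.2 * phi x
  end + dint (fun w => (tfirst x <= w.1)%R%:R * (h w.1 * phi (w :: x))).

Lemma omega_fvec_of h phi : omega nu h (fvec_of phi) = fvec_of (omS h phi).
Proof.
have annE n (x : n.-tuple (R * R)) : aann nu h (fvec_of phi) x =
    dint (fun w => (tfirst x <= w.1)%R%:R * (h w.1 * phi (w :: x))).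
  rewrite /aann /dint /fvec_of integral_mkcond; congr fine.
  apply: eq_integral => u _; rewrite patchE.
  rewrite (_ : (u \in _) = (tfirst x <= u)%R); last first.
    by apply/idP/idP; rewrite inE.
  case: ifP => _; first by apply: eq_integral => v _; rewrite mul1r.
  by rewrite integral0_eq// => v _; rewrite mul0r.
apply: functional_extensionality_dep => -[|n]; apply/funext => x;
    rewrite /omega /vadd annE /fvec_of /omS /acre /aneu.
  by rewrite tuple0 /= !add0r.
by case/tupleP: x => p y; rewrite theadE /= addrA.
Qed.

Section DoubleIntegral.
Variables (M al be : R).
Hypotheses (nuM : nu [set s | M < `|s|] = 0%E) (alLbe : al <= be).

(** Half-open, so that adjacent cells tile an interval without overlap. *)
Definition ico (t : R) : R := (al <= t < be)%R%:R.

Lemma ico_ge0 t : 0 <= ico t. Proof. exact: ler0n. Qed.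

Lemma measurable_ico : measurable_fun setT ico.
Proof.
rewrite (_ : ico = fun t => if al <= t < be then 1 else 0); last first.
  by apply/funext => t; rewrite /ico; case: ifP.
apply: measurable_fun_ifT => //; apply: measurable_and.
  by apply: measurable_fun_ler.
by apply: measurable_fun_ltr.
Qed.

Lemma integral_ico : (\int[leb]_u (ico (u : R))%:E = (be - al)%:E)%E.
Proof.
rewrite (_ : integral _ _ _ = \int[leb]_u (\1_(`[al, be[ : set R) (u : R))%:E)%E.
  have lE : leb `[al, be[%classic = (be - al)%:E.
    rewrite lebesgue_measure_itv /= lte_fin; case: ltP => //.
    by move=> bea; rewrite (le_anti (introT andP (conj alLbe bea))) subrr.
  have mI : measurable (`[al, be[ : set (measurableTypeR R)) by exact: measurable_itv.
  by rewrite (integral_indic _ measurableT mI) setIT; exact: lE.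
apply: eq_integral => u _; rewrite indicE /ico; congr (_%:R%:E).
by rewrite mem_setE in_itv.
Qed.

(** Domination by a multiple of the indicator gives integrability for the product measure. Fubini
    then identifies [dint] with a genuine integral, to which linearity and $|\int f|\le\int|f|$
    apply. *)
Lemma dint_bounded (f : R * R -> R) C : 0 <= C -> measurable_fun setT f ->
  (forall u v, `|f (u, v)| <= C * ico u) ->
  let mu := product_measure1 leb nu in
  [/\ mu.-integrable setT (EFin \o (f : measurableTypeR R * R -> R)),
     dint f = fine (\int[mu]_z (f z)%:E)%E & `|dint f| <= C * (be - al)].
Proof.
move=> C0 mf fC mu.
have mf' : measurable_fun setT (EFin \o (f : measurableTypeR R * R -> R)).
  exact/measurable_EFinP.
have mfi : measurable_fun setT (fun u : R => \int[nu]_v `|(f (u, v))%:E|)%E.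
  apply: (@measurable_integral_prob R nu _ _ (fun z : R * R => `|(f z)%:E|%E)) => //.
  by apply: measurableT_comp => //; exact/measurable_EFinP.
have mci : measurable_fun setT (fun u : R => C%:E * (ico u)%:E)%E.
  by apply/measurable_EFinP; apply: measurable_funM => //; exact: measurable_ico.
have bnd : (\int[leb]_u \int[nu]_v `|(f ((u : R), v))%:E| <= (C * (be - al))%:E)%E.
  apply: (@le_trans _ _ (\int[leb]_u (C%:E * (ico (u : R))%:E))%E).
    apply: ge0_le_integral => //.
    - by move=> u _; apply: integral_ge0.
    move=> u _; rewrite -[leRHS]mule1 -[X in (_ <= _ * X)%E](probability_setT nu).
    rewrite -integral_cst//; apply: ge0_le_integral => //.
    - apply: measurableT_comp => //; apply/measurable_EFinP.
      exact: (measurableT_comp mf (measurable_pair1 _)).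
    - by move=> v _ /=; rewrite lee_fin.
  rewrite ge0_integralZl//.
  - by rewrite integral_ico -EFinM.
  - by apply/measurable_EFinP; exact: measurable_ico.
  - by move=> u _; rewrite lee_fin ico_ge0.
have intf : mu.-integrable setT (EFin \o (f : measurableTypeR R * R -> R)).
  apply/(integrable12ltyP leb nu mf').
  exact: le_lt_trans bnd (ltry _).
have dE : dint f = fine (\int[mu]_z (f z)%:E)%E.
  by rewrite /dint -(integral12_prod_meas1 intf).
split=> //; rewrite dE.
have fin := integrable_fin_num measurableT intf.
rewrite -lee_fin -abse_EFin fineK//.
apply: le_trans (le_abse_integral _ _ _) _ => //.
rewrite fubini_tonelli1//; exact: measurableT_comp.
Qed.

(** Cutting off a null set of marks turns a bound valid only for $|v|\le M$ into the global one that
    [dint_bounded] asks for. *)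
Definition trunc (f : R * R -> R) w : R := (`|w.2| <= M)%R%:R * f w.

Lemma measurable_trunc (f : R * R -> R) : measurable_fun setT f -> measurable_fun setT (trunc f).
Proof.
move=> mf; apply: measurable_funM => //.
rewrite (_ : (fun _ => _) = fun w : R * R => if `|w.2| <= M then 1 else 0 : R).
  apply: measurable_fun_ifT => //; apply: measurable_fun_ler => //.
  by apply: measurableT_comp => //; exact: normr_measurable.
by apply/funext => w; case: ifP.
Qed.

Lemma dint_trunc (f : R * R -> R) : measurable_fun setT f -> dint f = dint (trunc f).
Proof.
move=> mf; congr fine; apply: eq_integral => u _.
apply: ae_eq_integral => //.
- by apply/measurable_EFinP; exact: (measurableT_comp mf (measurable_pair1 _)).
- apply/measurable_EFinP.
  exact: (measurableT_comp (measurable_trunc mf) (measurable_pair1 _)).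
apply: filterS (ae_norm_le nuM) => v vM _.
by rewrite /trunc /= vM mul1r.
Qed.

Lemma dint_congr (f g : R * R -> R) : measurable_fun setT f -> measurable_fun setT g ->
  (forall u v, `|v| <= M -> f (u, v) = g (u, v)) -> dint f = dint g.
Proof.
move=> mf mg fg; rewrite dint_trunc// [RHS]dint_trunc//; congr dint.
apply/funext => -[u v]; rewrite /trunc /=.
by have [vM|_] := boolP (`|v| <= M); rewrite ?mul0r// fg.
Qed.

Lemma trunc_bound (f : R * R -> R) C : 0 <= C -> (forall u v, `|v| <= M -> `|f (u, v)| <= C * ico u) ->
  forall u v, `|trunc f (u, v)| <= C * ico u.
Proof.
move=> C0 fC u v; rewrite /trunc /=.
have [vM|_] := boolP (`|v| <= M); rewrite ?mul1r ?fC//.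
by rewrite mul0r normr0 mulr_ge0// ico_ge0.
Qed.

Lemma dint_le (f : R * R -> R) C : 0 <= C -> measurable_fun setT f ->
  (forall u v, `|v| <= M -> `|f (u, v)| <= C * ico u) ->
  `|dint f| <= C * (be - al).
Proof.
move=> C0 mf fC; rewrite dint_trunc//.
by have [] := dint_bounded C0 (measurable_trunc mf) (trunc_bound C0 fC).
Qed.

Lemma dintZ (f : R * R -> R) C c : 0 <= C -> measurable_fun setT f ->
  (forall u v, `|v| <= M -> `|f (u, v)| <= C * ico u) ->
  dint (fun w => c * f w) = c * dint f.
Proof.
move=> C0 mf fC.
have mcf : measurable_fun setT (fun w => c * f w) by exact: measurable_funM.
rewrite dint_trunc// [in RHS]dint_trunc//.
have -> : trunc (fun w => c * f w) = (fun w => c * trunc f w).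
  by apply/funext => w; rewrite /trunc mulrCA.
have [int1 -> _] := dint_bounded C0 (measurable_trunc mf) (trunc_bound C0 fC).
have [|u v|_ -> _] := @dint_bounded (fun w => c * trunc f w) (`|c| * C) _
    (measurable_funM (measurable_cst _) (measurable_trunc mf)).
- by rewrite mulr_ge0.
- by rewrite normrM -mulrA ler_wpM2l// trunc_bound.
under eq_integral do rewrite EFinM.
by rewrite integralZl// fineM// integrable_fin_num.
Qed.

End DoubleIntegral.
End Operators.

(** * Powers of the field operator of a single interval *)

Section Cells.
Variables (R : realType) (nu : probability R R).
Implicit Types phi psi : seq (R * R) -> R.
Local Notation leb := (@lebesgue_measure R).

Lemma measurable_integral_prob_signed d (T : measurableType d)
  (f : T * R -> \bar R) : measurable_fun setT f ->
  measurable_fun setT (fun x => \int[nu]_s f (x, s))%E.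
Proof.
move=> mf; rewrite (_ : (fun _ => _) = (fun x =>
    \int[nu]_s (f^\+ (x, s)) - \int[nu]_s (f^\- (x, s)))%E); last first.
  apply/funext => x; rewrite [LHS]integralE.
  by congr (_ - _)%E; apply: eq_integral => s _; rewrite ?funeposE ?funenegE.
apply: emeasurable_funB.
  apply: (@measurable_integral_prob R nu _ _ f^\+%E) => //.
  exact: measurable_funepos.
apply: (@measurable_integral_prob R nu _ _ f^\-%E) => //.
exact: measurable_funeneg.
Qed.

Lemma measurable_integral_lebesgue_signed d (T : measurableType d)
  (f : T * R -> \bar R) : measurable_fun setT f ->
  measurable_fun setT (fun x => \int[leb]_s f (x, (s : R)))%E.
Proof.
move=> mf; rewrite (_ : (fun _ => _) = (fun x =>
    \int[leb]_s (f^\+ (x, (s : R))) - \int[leb]_s (f^\- (x, (s : R))))%E); last first.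
  apply/funext => x; rewrite [LHS]integralE.
  by congr (_ - _)%E; apply: eq_integral => s _; rewrite ?funeposE ?funenegE.
apply: emeasurable_funB.
  apply: (@measurable_integral_lebesgue R _ _ f^\+%E) => //.
  exact: measurable_funepos.
apply: (@measurable_integral_lebesgue R _ _ f^\-%E) => //.
exact: measurable_funeneg.
Qed.

Lemma measurable_dint d (T : measurableType d) (f : T * (R * R) -> R) :
  measurable_fun setT f -> measurable_fun setT (fun x => dint nu (fun w => f (x, w))).
Proof.
move=> mf; rewrite /dint.
apply: (measurableT_comp (fine_measurable _)) => //.
have m2 : measurable_fun setT (fun z : T * R => \int[nu]_v (f (z.1, (z.2, v)))%:E)%E.
  apply: (@measurable_integral_prob_signed _ _
    (fun z : (T * R) * R => (f (z.1.1, (z.1.2, z.2)))%:E)).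
  apply/measurable_EFinP.
  have mh : measurable_fun setT (fun z : T * R * R => (z.1.1, (z.1.2, z.2))).
    apply: measurable_fun_pair; first by apply: measurableT_comp.
    by apply: measurable_fun_pair => //; apply: measurableT_comp.
  exact: (measurableT_comp mf mh).
exact: (measurable_integral_lebesgue_signed m2).
Qed.

Lemma mseq_omS h phi : measurable_fun setT h -> mseq phi -> mseq (omS nu h phi).
Proof.
move=> mh mphi; rewrite /omS; apply: (@mseqD R
    (fun x => if x is p :: y then h p.1 * phi y + h p.1 * p.2 * phi x else 0)).
  apply/mseq_consP => n; apply: measurable_funD.
    apply: measurable_funM; last exact: measurable_comp_snd (mphi n).
    by apply: (measurable_comp_fst (f := fun p : R * R => h p.1)); exact: measurableT_comp.
  apply: measurable_funM; last by have /mseq_consP := mphi; exact.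
  apply: (measurable_comp_fst (f := fun p : R * R => h p.1 * p.2)).
  by apply: measurable_funM => //; exact: measurableT_comp.
move=> n; pose f (z : n.-tuple (R * R) * (R * R)) : R :=
  (tfirst z.1 <= z.2.1)%R%:R * (h z.2.1 * phi (z.2 :: z.1)).
apply: (@measurable_dint _ _ f).
have m1 : measurable_fun setT (fun z : n.-tuple (R * R) * (R * R) => z.1).
  exact: (@measurable_fst _ _ (n.-tuple (R * R))%type (R * R)%type).
have m2 : measurable_fun setT (fun z : n.-tuple (R * R) * (R * R) => z.2).
  exact: (@measurable_snd _ _ (n.-tuple (R * R))%type (R * R)%type).
have m21 : measurable_fun setT (fun z : n.-tuple (R * R) * (R * R) => z.2.1).
  exact: (measurableT_comp measurable_fst m2).
apply: measurable_funM.
  rewrite (_ : (fun _ => _) = fun z : n.-tuple (R * R) * (R * R) =>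
      if tfirst z.1 <= z.2.1 then 1 else 0 : R); last first.
    by apply/funext => z; case: ifP.
  apply: measurable_fun_ifT => //; apply: measurable_fun_ler => //.
  exact: (measurableT_comp (mseq_tfirst (n := n)) m1).
apply: measurable_funM; first exact: (measurableT_comp mh m21).
have m3 : measurable_fun setT (fun z : n.-tuple (R * R) * (R * R) => (z.2, z.1)).
  exact: measurable_fun_pair.
have /mseq_consP/(_ n) m4 := mphi.
exact: (measurableT_comp m4 m3).
Qed.

Definition vac (x : seq (R * R)) : R := (nilp x)%:R.

Lemma vacuum_fvec_of : @vacuum R = fvec_of vac.
Proof.
apply: functional_extensionality_dep => n; apply/funext => x.
by rewrite /fvec_of /vac /nilp size_tuple; case: n x.
Qed.

Lemma mseq_vac : mseq vac.
Proof.
move=> n; rewrite (_ : (fun _ => _) = cst ((n == 0)%N%:R : R)).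
  exact: measurable_cst.
by apply/funext => x; rewrite /vac /nilp size_tuple.
Qed.

Lemma B0_ico al be : 0 <= al -> @B0 R (ico al be).
Proof.
move=> al0; split; first exact: measurable_ico.
split; first by exists 1 => t _; rewrite /ico; case: (_ && _); rewrite ?normr1 ?normr0.
by exists be => t; rewrite /ico => /ltW bt; rewrite (le_gtF bt) andbF.
Qed.

Section Cell.
Variables (M al be : R).
Hypotheses (nuM : nu [set s | M < `|s|] = 0%E) (M0 : 0 <= M).
Hypotheses (al0 : 0 <= al) (alLbe : al <= be).
Local Notation h := (ico al be).
Local Notation inBox := (@inBox R M).

Definition rho k := iter k (omS nu h) vac.

Lemma mseq_rho k : mseq (rho k).
Proof.
elim: k => [|k IH]; first exact: mseq_vac.
by apply: mseq_omS => //; exact: measurable_ico.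
Qed.

Lemma measurable_kernel phi x : mseq phi ->
  measurable_fun setT (fun w : R * R =>
    (tfirst x <= w.1)%R%:R * (h w.1 * phi (w :: x))).
Proof.
move=> mphi; apply: measurable_funM.
  rewrite (_ : (fun _ => _) = fun z : R * R =>
      if tfirst x <= z.1 then 1 else 0 : R); last first.
    by apply/funext => z; case: ifP.
  by apply: measurable_fun_ifT => //; exact: measurable_fun_ler.
apply: measurable_funM.
  by apply: measurableT_comp => //; exact: measurable_ico.
have /mseq_consP/(_ (size x)) m4 := mphi.
have m3 : measurable_fun setT (fun z : R * R => (z, in_tuple x)).
  exact: measurable_pair2.
exact: (measurableT_comp m4 m3).
Qed.

Lemma ico_le1 t : `|h t| <= 1.
Proof. by rewrite /ico; case: (_ && _); rewrite ?normr1 ?normr0. Qed.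

Lemma inBox_cons (p : R * R) x :
  inBox (p :: x) = [&& tfirst x <= p.1, `|p.2| <= M & inBox x].
Proof.
by rewrite /inBox in_S_cons /=; case: (_ <= _); case: (in_S x); case: (_ <= _).
Qed.

Lemma kernel_bound phi x C : inBox x -> 0 <= C ->
  (forall y, inBox y -> `|phi y| <= C) ->
  forall u v, `|v| <= M ->
  `|(tfirst x <= u)%R%:R * (h u * phi ((u, v) :: x))| <= C * h u.
Proof.
move=> xB C0 phiC u v vM.
case: (leP (tfirst x) u) => tu; last first.
  by rewrite mul0r normr0 mulr_ge0// ico_ge0.
rewrite mul1r normrM ger0_norm ?ico_ge0// mulrC ler_wpM2r ?ico_ge0//.
by apply: phiC; rewrite inBox_cons /= tu vM.
Qed.

(** In sup norm, creation costs a factor 1, the neutral operator a factor [M], and annihilation the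
    length of the interval. *)
Lemma omS_bound phi C x : 0 <= C -> mseq phi ->
  (forall y, inBox y -> `|phi y| <= C) -> inBox x ->
  `|omS nu h phi x| <= C * (1 + M + (be - al)).
Proof.
move=> C0 mphi phiC xB; rewrite /omS.
have dB := dint_le nuM alLbe C0 (measurable_kernel x mphi) (kernel_bound xB C0 phiC).
apply: (le_trans (ler_normD _ _)); rewrite mulrDr lerD//.
case: x xB {dB} => [|p y] xB; first by rewrite normr0 mulr_ge0// addr_ge0.
have := xB; rewrite inBox_cons => /and3P[_ pM yB].
apply: (le_trans (ler_normD _ _)); rewrite mulrDr mulr1 lerD//.
  by rewrite normrM -[leRHS]mul1r ler_pM// ?ico_le1// phiC.
rewrite !normrM [leRHS]mulrC ler_pM// ?phiC//.
by rewrite -[leRHS]mul1r ler_pM// ico_le1.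
Qed.

(** The bound is in terms of any [B] above the length, so that one constant serves all cells of all
    subdivisions. *)
Lemma rho_bound B k x : be - al <= B -> inBox x ->
  `|rho k x| <= (1 + M + B) ^+ k.
Proof.
move=> LB; have B0 : 0 <= B by apply: le_trans LB; rewrite subr_ge0.
have K0 : 0 <= 1 + M + B by rewrite !addr_ge0.
elim: k x => [|k IH] x xB /=.
  by rewrite /vac expr0; case: nilp; rewrite ?normr1 ?normr0.
apply: (le_trans (omS_bound (exprn_ge0 k K0) (mseq_rho k) IH xB)).
by rewrite exprSr ler_wpM2l ?exprn_ge0// lerD2l.
Qed.

Lemma rho_size k x : in_S x -> (k < size x)%N -> rho k x = 0.
Proof.
elim: k x => [|k IH] x xS kx /=.
  by rewrite /vac; case: x kx {xS}.
rewrite /omS (_ : dint _ _ = 0) ?addr0.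
  case: x xS kx => [|p y] // xS kx; rewrite IH ?mulr0 ?IH ?mulr0 ?addr0//.
    exact: ltnW.
  by move: xS; rewrite in_S_cons => /andP[].
apply/eqP; rewrite -normr_le0 -(mul0r (be - al)).
apply: (dint_le nuM alLbe) => //; first exact: measurable_kernel (mseq_rho k).
move=> u v vM; case: (leP (tfirst x) u) => tu; last by rewrite !mul0r normr0.
have -> : rho k ((u, v) :: x) = 0.
  by apply: IH; [rewrite in_S_cons /= tu|rewrite /=; lia].
by rewrite !mulr0 normr0 mul0r.
Qed.

(** Particles are only created inside the interval. In the annihilation term, [x] with one more
    point still contains its offending point. *)
Lemma rho_support k x : in_S x -> ~~ all (fun p => al <= p.1 < be) x ->
  rho k x = 0.
Proof.
elim: k x => [|k IH] x xS xc /=; first by rewrite /vac; case: x xc {xS}.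
rewrite /omS (_ : dint _ _ = 0) ?addr0.
  case: x xS xc => [|p y] // xS xc; rewrite (IH (p :: y))// mulr0 addr0.
  move: xc; rewrite /= negb_and /ico; case: (_ && _) => /=; last by rewrite mul0r.
  by move=> yc; rewrite IH ?mulr0//; move: xS; rewrite in_S_cons => /andP[].
apply/eqP; rewrite -normr_le0 -(mul0r (be - al)).
apply: (dint_le nuM alLbe) => //; first exact: measurable_kernel (mseq_rho k).
move=> u v vM; case: (leP (tfirst x) u) => tu; last by rewrite !mul0r normr0.
have -> : rho k ((u, v) :: x) = 0.
  by apply: IH; [rewrite in_S_cons /= tu|rewrite /= negb_and xc orbT].
by rewrite !mulr0 normr0 mul0r.
Qed.

(** Only annihilation leads back to the vacuum sector, and it integrates a bounded function over an
    interval of length [be - al]. *)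
Lemma rho_nil B k : be - al <= B ->
  `|rho k.+1 [::]| <= (1 + M + B) ^+ k * (be - al).
Proof.
move=> LB; have B0 : 0 <= B by apply: le_trans LB; rewrite subr_ge0.
have K0 : 0 <= 1 + M + B by rewrite !addr_ge0.
rewrite /= /omS add0r; apply: (dint_le nuM alLbe).
- exact: exprn_ge0.
- exact: measurable_kernel (mseq_rho k).
apply: kernel_bound => //; first exact: exprn_ge0.
by move=> y; exact: rho_bound.
Qed.

(** The three summands are the errors made by one more application: creation on top of the vacuum
    component, the neutral operator acting on the old error, and annihilation. *)
Fixpoint rho_err B k : R :=
  if k is j.+1 then (1 + M + B) ^+ j + M * rho_err B j + (1 + M + B) ^+ j.+1 else 0.

(** The first application creates the particle; afterwards only the neutral operator is of order
    one, and each use of it multiplies by the mark. *)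
Lemma rho_single B k (p : R * R) : be - al <= B -> inBox [:: p] ->
  `|rho k.+1 [:: p] - h p.1 * p.2 ^+ k| <= rho_err B k * (be - al).
Proof.
move=> LB pB; have B0 : 0 <= B by apply: le_trans LB; rewrite subr_ge0.
have K0 : 0 <= 1 + M + B by rewrite !addr_ge0.
have pM : `|p.2| <= M by move: pB; rewrite inBox_cons => /and3P[].
elim: k => [|k IH].
  rewrite mul0r normr_le0 /= /omS /= {1 2}/vac /= expr0 !mulr1 mulr0 addr0.
  rewrite addrAC subrr add0r -normr_le0 -(mul0r (be - al)).
  apply: (dint_le nuM alLbe) => //; first exact: measurable_kernel mseq_vac.
  by move=> u v vM; rewrite /vac /= !mulr0 normr0 mul0r.
(* An indicator is idempotent, so repeated neutral operators leave a single factor [h]. *)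
have hh : h p.1 * h p.1 = h p.1 by rewrite /ico; case: (_ && _); rewrite ?mulr1 ?mulr0.
rewrite [rho k.+2]iterS -/(rho k.+1) {1}/omS.
set D := dint _ _.
have DB : `|D| <= (1 + M + B) ^+ k.+1 * (be - al).
  apply: (dint_le nuM alLbe).
  - exact: exprn_ge0.
  - exact: measurable_kernel (mseq_rho k.+1).
  apply: kernel_bound => //; first exact: exprn_ge0.
  by move=> y; exact: rho_bound.
rewrite (_ : _ - _ = h p.1 * rho k.+1 [::]
    + h p.1 * p.2 * (rho k.+1 [:: p] - h p.1 * p.2 ^+ k) + D); last first.
  rewrite mulrBr (_ : h p.1 * p.2 * (h p.1 * p.2 ^+ k) = h p.1 * p.2 ^+ k.+1).
    by ring.
  by rewrite mulrACA hh exprS.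
apply: (le_trans (ler_normD _ _)).
rewrite [rho_err B k.+1]/= mulrDl lerD//.
apply: (le_trans (ler_normD _ _)).
rewrite mulrDl lerD//.
  rewrite normrM -[leRHS]mul1r ler_pM ?ico_le1//; exact: rho_nil.
rewrite 2!normrM -mulrA -[leRHS]mul1r -mulrA ler_pM// ?mulr_ge0// ?ico_le1//.
by rewrite ler_pM.
Qed.

(** On [in_S] the times decrease, so [hi x] is an initial segment of [x] and [lo x] is the remaining
    tail. *)
Definition hi (x : seq (R * R)) := [seq p <- x | al <= p.1].
Definition lo (x : seq (R * R)) := [seq p <- x | p.1 < al].

Lemma lo_hi_nil x : in_S x -> tfirst x < al -> hi x = [::] /\ lo x = x.
Proof.
elim: x => [|p x IH] //; rewrite in_S_cons => /andP[xp xS].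
rewrite {1}/tfirst /= => pal; have [-> ->] := IH xS (le_lt_trans xp pal).
by rewrite pal leNgt pal.
Qed.

Lemma tfirst_hi x : in_S x -> al <= tfirst x -> tfirst (hi x) = tfirst x.
Proof. by case: x => [|p x] //=; rewrite /tfirst /= => _ ->. Qed.

Lemma hi_nilP x : in_S x -> hi x != [::] -> al <= tfirst x.
Proof.
move=> xS; case: leP => // /(lo_hi_nil xS)[-> _]; by rewrite eqxx.
Qed.

Lemma inBox_hi x : inBox x -> inBox (hi x).
Proof.
elim: x => [|p x IH] //=; rewrite inBox_cons => /and3P[xp pM xB].
case: ifP => pal; last exact: IH.
rewrite inBox_cons pM (IH xB) !andbT.
have [xS _] := andP xB.
have [xal|alx] := ltP (tfirst x) al; last by rewrite tfirst_hi.
have [-> _] := lo_hi_nil xS xal; rewrite /tfirst /=.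
exact: le_trans (in_S_tfirst xS) xp.
Qed.

Lemma inBox_lo x : inBox x -> inBox (lo x).
Proof.
elim: x => [|p x IH] //=; rewrite inBox_cons => /and3P[xp pM xB].
case: ifP => pal; last exact: IH.
have [xS _] := andP xB.
have [_ ->] := lo_hi_nil xS (le_lt_trans xp pal).
by rewrite inBox_cons xp pM.
Qed.

(* Below the cell, [psi] plays the role of a vacuum: the operators
   only see the particles located at times at least [al]. *)
Lemma iter_omS_tensor psi k x : mseq psi ->
  (forall y, inBox y -> y != [::] -> al <= tfirst y -> psi y = 0) ->
  inBox x -> iter k (omS nu h) psi x = rho k (hi x) * psi (lo x).
Proof.
move=> mpsi psi0; elim: k x => [|k IH] x xB.
  have [xS _] := andP xB.
  have [xal|alx] := ltP (tfirst x) al.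
    by have [-> ->] := lo_hi_nil xS xal; rewrite /rho /= /vac mul1r.
  case: x alx xB xS => [|p x] alx xB xS; first by rewrite /rho /= /vac mul1r.
  rewrite [LHS]/= [LHS]psi0//.
  by rewrite /tfirst /= in alx; rewrite /rho /= alx /vac mul0r.
have [xS _] := andP xB.
have mit j : mseq (iter j (omS nu h) psi).
  elim: j => [|j IHj] //=; apply: mseq_omS => //; exact: measurable_ico.
(* The integrated particle lies in the cell, so it joins [hi x], and the factor [psi (lo x)] comes
   out of the integral. *)
have dE : dint nu (fun w => (tfirst x <= w.1)%R%:R *
       (h w.1 * iter k (omS nu h) psi (w :: x))) =
   psi (lo x) * dint nu (fun w => (tfirst (hi x) <= w.1)%R%:R *
       (h w.1 * rho k (w :: hi x))).
  have L0 : be - al <= be - al by [].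
  have K0 : 0 <= 1 + M + (be - al) by apply: addr_ge0; rewrite ?subr_ge0 // addr_ge0.
  rewrite -(dintZ nuM alLbe _ (exprn_ge0 k K0) (measurable_kernel _ (mseq_rho k))
     (kernel_bound (inBox_hi xB) (exprn_ge0 k K0) (fun y => rho_bound k L0))).
  apply: (dint_congr nuM); first exact: measurable_kernel.
    apply: measurable_funM => //.
    exact: measurable_kernel (mseq_rho k).
  move=> u v vM /=; rewrite {1 3}/ico.
  case: (boolP (al <= u < be)) => [/andP[alu _]|_]; last by rewrite !mul0r !mulr0.
  have -> : (tfirst (hi x) <= u) = (tfirst x <= u).
    (* If no particle reaches [al], then [hi x] is empty with default first time 0, and both
       comparisons hold since $t_1<\alpha\le u$ and $0\le\alpha$. *)
    have [xal|alx] := ltP (tfirst x) al; last by rewrite tfirst_hi.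
    have [-> _] := lo_hi_nil xS xal.
    by rewrite /tfirst /= (le_trans al0 alu) (ltW (lt_le_trans xal alu)).
  case: (leP (tfirst x) u) => xu; last by rewrite !mul0r !mulr0.
  rewrite IH; last by rewrite inBox_cons /= xu vM.
  by rewrite /hi /lo /= alu ltNge alu /= !mul1r mulrC.
rewrite iterS {1}/omS dE {dE} [in RHS]/rho iterS -/(rho k) [in RHS]/omS.
rewrite mulrDl [psi _ * _]mulrC; congr (_ + _).
case: x xB xS => [|p y] xB xS; first by rewrite mul0r.
have yB : inBox y by move: xB; rewrite inBox_cons => /and3P[].
rewrite !IH//; have [alp|pal] := leP al p.1.
  by rewrite /hi /lo /= alp ltNge alp /= mulrDl !mulrA.
have [-> _] := lo_hi_nil xS pal.
by rewrite /ico leNgt pal /= !mul0r addr0.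
Qed.

End Cell.
End Cells.

(** * The contribution of one cell, with its vacuum part removed *)

Section CellTerm.
Variables (R : realType) (nu : probability R R) (M a0 al be : R).
Hypotheses (nuM : nu [set s | M < `|s|] = 0%E) (M0 : 0 <= M).
Hypotheses (al0 : 0 <= al) (alLbe : al <= be) (a0al : a0 <= al).
Variables (psi : seq (R * R) -> R) (C : R).
Hypotheses (mpsi : mseq psi)
  (psi_below : forall x, inBox M x -> x != [::] -> a0 <= tfirst x -> psi x = 0)
  (psiC : forall x, inBox M x -> `|psi x| <= C).

(** Where no particle reaches the cell, the tensor formula gives exactly [rho k [::] * psi].
    Subtracting it confines the term to $t_1\in[\alpha,\beta)$; these multiples of [psi] are only of
    the order of the cell length, so their sum over all cells need not be small. *)
Definition cterm k x := iter k (omS nu (ico al be)) psi x - rho nu al be k [::] * psi x.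

Let psi_below' x : inBox M x -> x != [::] -> al <= tfirst x -> psi x = 0.
Proof. by move=> xS x0 alx; apply: psi_below => //; exact: le_trans alx. Qed.

Let tensor k x : inBox M x -> iter k (omS nu (ico al be)) psi x =
  rho nu al be k (hi al x) * psi (lo al x).
Proof. exact: (iter_omS_tensor nuM M0 al0 alLbe k mpsi psi_below'). Qed.

Lemma inBox_S x : inBox M x -> in_S x. Proof. by case/andP. Qed.

Lemma mseq_cterm k : mseq (cterm k).
Proof.
apply: mseqB; last exact: mseqZ.
elim: k => [|k IH] //=; apply: mseq_omS => //; exact: measurable_ico.
Qed.

Lemma cterm_nil k : cterm k [::] = 0.
Proof.
have nilB : inBox M [::] by [].
by rewrite /cterm tensor// /hi /lo /= subrr.
Qed.

Lemma cterm_in k p y : inBox M (p :: y) -> al <= p.1 ->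
  cterm k (p :: y) = rho nu al be k (hi al (p :: y)) * psi (lo al (p :: y)).
Proof.
move=> xB alp; rewrite /cterm tensor// [X in _ - X](_ : _ = 0) ?subr0//.
by rewrite psi_below' ?mulr0.
Qed.

Lemma cterm_out k p y : inBox M (p :: y) -> ~~ (al <= p.1 < be) ->
  cterm k (p :: y) = 0.
Proof.
move=> xB pc; have xS := inBox_S xB.
have [alp|pal] := leP al p.1.
  rewrite cterm_in// (rho_support nuM) ?mul0r//.
    exact: inBox_S (inBox_hi al xB).
  by rewrite /hi /= alp /= negb_and pc.
by rewrite /cterm tensor//; have [-> ->] := lo_hi_nil xS pal; rewrite subrr.
Qed.

Lemma cterm_bound B k x : be - al <= B -> inBox M x ->
  `|cterm k x| <= (1 + M + B) ^+ k * C.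
Proof.
move=> LB; have B0 : 0 <= B by apply: le_trans LB; rewrite subr_ge0.
have K0 : 0 <= 1 + M + B by rewrite !addr_ge0.
case: x => [|p y] xB.
  rewrite cterm_nil normr0 mulr_ge0 ?exprn_ge0//.
  exact: le_trans (psiC xB).
have [/andP[alp _]|pc] := boolP (al <= p.1 < be); last first.
  by rewrite cterm_out// normr0 mulr_ge0 ?exprn_ge0// (le_trans _ (psiC xB)).
rewrite cterm_in// normrM ler_pM//.
  by apply: (rho_bound nuM) => //; exact: inBox_hi.
by apply: psiC; exact: inBox_lo.
Qed.

(** With only the leading particle in the cell, [hi] is [[:: p]] and [lo] is [y], so the error is
    the one of [rho_single] times the bound on [psi]. *)
Lemma cterm_target B k p y : be - al <= B -> inBox M (p :: y) ->
  al <= p.1 < be -> (y == [::]) || (tfirst y < al) ->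
  `|cterm k.+1 (p :: y) - p.2 ^+ k * psi y| <= rho_err M B k * (be - al) * C.
Proof.
move=> LB xB pc yal; have /andP[alp _] := pc.
have yB : inBox M y by move: xB; rewrite inBox_cons => /and3P[].
have [hy ly] : hi al y = [::] /\ lo al y = y.
  case/orP: yal => [/eqP ->//|]; exact: lo_hi_nil (inBox_S yB).
rewrite cterm_in// /hi /lo /= alp ltNge alp /= -/(hi al y) -/(lo al y) hy ly.
rewrite -mulrBl normrM ler_pM//; last exact: psiC.
have pB : inBox M [:: p].
  move: xB; rewrite !inBox_cons => /and3P[yp -> _]; rewrite andbT.
  rewrite /tfirst /=; exact: le_trans al0 alp.
have := rho_single nuM M0 alLbe k LB pB.
by rewrite [ico _ _ _]/ico pc mul1r.
Qed.

Lemma cterm_size k n x : (forall y, inBox M y -> (n < size y)%N -> psi y = 0) ->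
  inBox M x -> (n + k < size x)%N -> cterm k x = 0.
Proof.
move=> psin xB nx.
have szx : (size (hi al x) + size (lo al x) = size x)%N.
  rewrite /hi /lo !size_filter -[RHS](count_predC (fun p : R * R => al <= p.1)).
  by congr (_ + _)%N; apply: eq_count => p /=; rewrite ltNge.
rewrite /cterm tensor// [X in _ - X](_ : _ = 0) ?subr0; last first.
  by rewrite psin ?mulr0//; lia.
have [hk|kh] := leqP (size (hi al x)) k.
  rewrite (psin (lo al x)) ?mulr0//; first exact: inBox_lo.
  rewrite -(ltn_add2l (size (hi al x))) szx; apply: leq_ltn_trans nx.
  by rewrite addnC leq_add2l.
rewrite (rho_size nuM) ?mul0r//; exact: inBox_S (inBox_hi al xB).
Qed.

End CellTerm.

(** * Uniform subdivisions of an interval *)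

Section Cuts.
Variables (R : realType) (al be : R).
Hypothesis alLbe : al <= be.

Definition cut N i : R := al + i%:R * ((be - al) / N.+1%:R).

Lemma cut0 N : cut N 0 = al. Proof. by rewrite /cut mul0r addr0. Qed.

Lemma cut_last N : cut N N.+1 = be.
Proof.
by rewrite /cut mulrC divfK ?pnatr_eq0// addrC subrK.
Qed.

Lemma cutS N i : cut N i.+1 = cut N i + (be - al) / N.+1%:R.
Proof. by rewrite /cut -addrA -[in LHS]natr1 mulrDl mul1r. Qed.

Lemma cell_ge0 N : 0 <= (be - al) / N.+1%:R.
Proof. by rewrite divr_ge0// subr_ge0. Qed.

Lemma cut_le N i j : (i <= j)%N -> cut N i <= cut N j.
Proof. by move=> ij; rewrite lerD2l ler_wpM2r ?cell_ge0// ler_nat. Qed.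

Lemma cut_exists N t : al <= t < be ->
  exists2 i : 'I_N.+1, cut N i <= t < cut N i.+1 &
    forall j : 'I_N.+1, j != i -> ~~ (cut N j <= t < cut N j.+1).
Proof.
move=> /andP[alt tbe].
have : cut N N.+1 > t by rewrite cut_last.
have : forall m, t < cut N m -> exists2 i, (i < m)%N & cut N i <= t < cut N i.+1.
  elim=> [|m IH] tm; first by rewrite cut0 ltNge alt in tm.
  have [tm'|mt] := ltP t (cut N m).
    by have [i im ?] := IH tm'; exists i => //; exact: ltnW.
  by exists m; rewrite ?mt.
move=> /[apply] -[i iN /andP[it ti]].
exists (Ordinal iN); first by rewrite /= it.
move=> j; rewrite -val_eqE /= neq_ltn => /orP[ji|ij]; rewrite negb_and -leNgt -ltNge.
  by rewrite (le_trans (cut_le N ji) it) orbT.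
by rewrite (lt_le_trans ti (cut_le N ij)).
Qed.

Lemma cvg_cell_size : (be - al) / N.+1%:R @[N --> \oo] --> (0 : R).
Proof. by rewrite -[0](mulr0 (be - al)); apply: cvgMr; exact: cvg_harmonic. Qed.

(* Once the mesh is finer than the gap between the first two times, the
   second particle lies below the cell of the first one. *)
Lemma eventually_below_cell (p : R * R) y :
  sorted (fun a b : R * R => b.1 < a.1) (p :: y) ->
  \forall N \near \oo, forall i, p.1 < cut N i.+1 ->
    (y == [::]) || (tfirst y < cut N i).
Proof.
case: y => [_|q y] /=; first by apply: nearW.
move=> /andP[qp _]; move: qp; rewrite -subr_gt0 => qp.
move/cvgr0Pnorm_lt : cvg_cell_size => /(_ _ qp); apply: filterS => N.
rewrite ger0_norm ?cell_ge0// /tfirst /= => h i; rewrite cutS => pi.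
apply: (@lt_trans _ _ (p.1 - (be - al) / N.+1%:R)).
  by rewrite ltrBrDl -ltrBrDr.
by rewrite ltrBlDr.
Qed.

End Cuts.

(** * Bounded convergence, tensoring with one particle, and reachable vectors *)

Section Approximation.
Variables (R : realType) (nu : probability R R) (M : R).
Hypotheses (nuM : nu [set s | M < `|s|] = 0%E) (M0 : 0 <= M).
Local Notation leb := (@lebesgue_measure R).
Local Notation inBox := (@inBox R M).
Implicit Types phi psi : seq (R * R) -> R.

Lemma mseq_box (T : R) : mseq (all (fun p : R * R => 0 <= p.1 <= T)).
Proof. by apply: mseq_all; apply: measurable_and; apply: measurable_fun_ler. Qed.

Lemma N2_bounded_cvg0 (g : nat -> seq (R * R) -> R) (K T : R) (n0 : nat) :
  (forall N, mseq (g N)) -> (forall N x, inBox x -> `|g N x| <= K) ->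
  (forall N x, inBox x -> T < tfirst x -> g N x = 0) ->
  (forall N x, inBox x -> (n0 < size x)%N -> g N x = 0) ->
  (forall x, inBox x -> sorted (fun a b : R * R => b.1 < a.1) x ->
     g N x @[N --> \oo] --> 0) ->
  (N2 nu (g N) @[N --> \oo] --> 0)%E.
Proof.
move=> mg gK gT gs gc.
have K0 : 0 <= K by apply: le_trans (gK 0%N [::] isT).
pose G (x : seq (R * R)) : R :=
  K * ((size x <= n0)%N && all (fun p : R * R => 0 <= p.1 <= T) x)%:R.
have mG : mseq G.
  apply: mseqZ; apply: mseq_natr => n.
  apply: measurable_and; last exact: mseq_box.
  rewrite (_ : (fun _ => _) = cst (n <= n0)%N); first exact: measurable_cst.
  by apply/funext => x; rewrite size_tuple.
apply: (N2_dominated_cvg0 nuM mg mG (n0 := n0)) => //.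
  move=> N x xB; have xS := inBox_S xB.
  rewrite /G normrM (ger0_norm K0).
  have [nx|xn] := ltnP n0 (size x); first by rewrite gs// normr0 mulr_ge0.
  have [Tx|xT] := ltP T (tfirst x); first by rewrite gT// normr0 mulr_ge0.
  by rewrite in_S_all_le// normr1 mulr1 gK.
(* The maximum with 0 keeps the empty sequence, whose default first time is 0, within the time
   horizon even if [T] is negative. *)
apply: (@N2_bounded_lty _ _ _ nuM G K (Num.max T 0) n0) => //.
- move=> x _; rewrite /G normrM (ger0_norm K0) ler_piMr//.
  by case: (_ && _); rewrite ?normr1 ?normr0.
- move=> x xS; rewrite gt_max => /andP[Tx x0].
  case: x xS Tx x0 => [|p x] xS; rewrite /tfirst /= ?ltxx// => Tp _.
  by rewrite /G /= (lt_geF Tp) !andbF mulr0.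
- by move=> x _ nx; rewrite /G leqNgt nx mulr0.
Qed.

Definition tens k (al be : R) phi (x : seq (R * R)) : R :=
  if x is p :: y then ico al be p.1 * p.2 ^+ k * phi y else 0.

Lemma mseq_tens k al be phi : mseq phi -> mseq (tens k al be phi).
Proof.
move=> mphi; apply/mseq_consP => n /=; apply: measurable_funM.
  apply: (measurable_comp_fst (f := fun p : R * R => ico al be p.1 * p.2 ^+ k)).
  apply: measurable_funM; first by apply: measurableT_comp => //; exact: measurable_ico.
  exact: measurable_funX.
exact: measurable_comp_snd (mphi n).
Qed.

(** Tensoring is bounded because the constraint between $t_1$ and the later times may be dropped,
    after which the integral over the leading particle factors out. This carries approximation
    errors through [tens]. *)
Lemma N2_tens k al be phi : al <= be -> mseq phi ->
  (N2 nu (tens k al be phi) <= ((be - al) * (M ^+ k) ^+ 2)%:E * N2 nu phi)%E.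
Proof.
move=> alLbe mphi; rewrite /N2 -nneseriesZl; last by move=> i _; exact: norm2_ge0.
rewrite nneseries_recl//; last by move=> i _; exact: norm2_ge0.
rewrite norm2_eq0; last by case.
rewrite add0e -nneseries_addn; last by move=> i; exact: norm2_ge0.
apply: lee_nneseries => [i _ _|n _]; first exact: norm2_ge0.
rewrite addn1.
set Nf := norm2 nu (fun x : n.-tuple (R * R) => phi x).
have Nf0 : (0 <= Nf)%E by exact: norm2_ge0.
pose c := (M ^+ k) ^+ 2.
have c0 : 0 <= c by exact: sqr_ge0.
(* This majorant drops the condition [tfirst y <= p.1] and replaces $|s|^k$ by $M^k$. *)
pose G (x : seq (R * R)) : R := if x is p :: y then
   c * ico al be p.1 * ((in_S y)%:R * phi y ^+ 2) else 0.
have mS := measurable_norm2_integrand (n := n) mphi.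
have mG : mseq G.
  apply/mseq_consP => m /=; apply: measurable_funM.
    apply: (measurable_comp_fst (f := fun p : R * R => c * ico al be p.1)).
    by apply: measurable_funM => //; apply: measurableT_comp => //; exact: measurable_ico.
  apply: (measurable_comp_snd (f := fun y : m.-tuple (R * R) =>
    (in_S y)%:R * phi y ^+ 2)).
  by have /measurable_EFinP := measurable_norm2_integrand (n := m) mphi.
have G0 x : 0 <= G x.
  case: x => [|p y] //=; apply: mulr_ge0.
    by apply: mulr_ge0; [exact: c0|exact: ico_ge0].
  by apply: mulr_ge0; [exact: ler0n|exact: sqr_ge0].
apply: (@le_trans _ _ (iint nu (fun x : n.+1.-tuple (R * R) => (G x)%:E))).
  apply: le_iint_ae.
  - exact: measurable_norm2_integrand (mseq_tens k al be mphi).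
  - by apply/measurable_EFinP; exact: mG.
  - by move=> x; exact: norm2_integrand_ge0.
  - by move=> x; rewrite lee_fin.
  apply: iaeS (iae_all_snd_le n.+1 nuM) => x; rewrite lee_fin.
  case/tupleP: x => p y /= /andP[pM yM]; rewrite in_S_cons.
  case: (in_S y); rewrite ?andbF ?mul0r ?mulr0 ?andbT// mul1r.
  apply: (@le_trans _ _ ((ico al be p.1 * p.2 ^+ k * phi y) ^+ 2)).
    by case: (tfirst y <= _); rewrite ?mul1r// mul0r sqr_ge0.
  rewrite 2!exprMn ler_wpM2r ?sqr_ge0// mulrC ler_pM ?sqr_ge0//.
    rewrite -real_normK ?num_real// /c lerXn2r ?nnegrE// ?exprn_ge0//.
    by rewrite normrX lerXn2r ?nnegrE.
  by rewrite /ico; case: (_ && _); rewrite ?expr1n ?expr0n.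
rewrite /= (_ : integral _ _ _ =
    \int[leb]_t ((c%:E * Nf) * (ico al be (t : R))%:E))%E; last first.
  apply: eq_integral => t _.
  rewrite (_ : (fun s => _) = cst ((c%:E * Nf) * (ico al be (t : R))%:E)%E).
    rewrite integral_cst//= [X in (_ * X)%E](_ : _ = 1%E) ?mule1//.
    exact: probability_setT.
  apply/funext => s /=; rewrite muleAC -EFinM /Nf /norm2 -iintZ//.
  - by apply: mulr_ge0 => //; exact: ico_ge0.
  - by move=> y; exact: norm2_integrand_ge0.
have mi : measurable_fun setT (fun t : R => (ico al be t)%:E).
  by apply/measurable_EFinP; exact: measurable_ico.
rewrite ge0_integralZl//.
- by rewrite integral_ico// muleAC -EFinM [c * _]mulrC.
- by move=> t _; rewrite lee_fin ico_ge0.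
- by apply: mule_ge0; [rewrite lee_fin|exact: Nf0].
Qed.

Definition reach phi : Prop :=
  exists P, inA nu P /\ P (@vacuum R) = fvec_of phi.

Lemma reach_vac : reach (@vac R).
Proof. by exists id; split; [exact: inA_id|exact: vacuum_fvec_of]. Qed.

Lemma reachD phi psi : reach phi -> reach psi -> reach (fun x => phi x + psi x).
Proof.
move=> [P [AP Pv]] [Q [AQ Qv]]; exists (fun F => vadd (P F) (Q F)).
by split; [exact: inA_add|rewrite Pv Qv].
Qed.

Lemma reachZ c phi : reach phi -> reach (fun x => c * phi x).
Proof.
move=> [P [AP Pv]]; exists (fun F => vscale c (P F)).
by split; [exact: inA_scale|rewrite Pv].
Qed.

Lemma reach_omS h phi : B0 h -> reach phi -> reach (omS nu h phi).
Proof.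
move=> Bh [P [AP Pv]]; exists (fun F => omega nu h (P F)).
split; first by apply: (inA_mul (P := omega nu h)) => //; exact: inA_omega.
by rewrite Pv omega_fvec_of.
Qed.

Lemma reach_sum N (phi : nat -> seq (R * R) -> R) :
  (forall i, (i < N)%N -> reach (phi i)) -> reach (fun x => \sum_(i < N) phi i x).
Proof.
elim: N => [|N IH] H.
  rewrite (_ : (fun _ => _) = (fun x => 0 * vac x)); first exact: reachZ reach_vac.
  by apply/funext => x; rewrite big_ord0 mul0r.
rewrite (_ : (fun _ => _) = (fun x => \sum_(i < N) phi i x + phi N x)).
  by apply: reachD; [apply: IH => i iN; apply: H; exact: ltnW|exact: H].
by apply/funext => x; rewrite big_ord_recr.
Qed.

Lemma reach_cterm al be psi k : 0 <= al -> reach psi ->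
  reach (cterm nu al be psi k).
Proof.
move=> al0 rpsi.
have -> : cterm nu al be psi k =
    (fun x => iter k (omS nu (ico al be)) psi x + - rho nu al be k [::] * psi x).
  by apply/funext => x; rewrite /cterm mulNr.
apply: reachD; last exact: reachZ.
by elim: k => [|k IH] //=; apply: reach_omS => //; exact: B0_ico.
Qed.

(** The class preserved by the inductive step: boundedness feeds the cell estimates, vanishing for
    $t_1\ge b$ makes the vector a vacuum for cells above [b], and finitely many particles keep
    dominated convergence in finitely many sectors. *)
Record good (b : R) phi : Prop := Good {
  good_mseq : mseq phi;
  good_bound : exists C, forall x, inBox x -> `|phi x| <= C;
  good_below : forall x, inBox x -> x != [::] -> b <= tfirst x -> phi x = 0;
  good_size : exists n, forall x, inBox x -> (n < size x)%N -> phi x = 0 }.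

(** The approximants have to be [good], since the next tensor step starts from them; [phi] itself
    may be unbounded. *)
Definition appr (b : R) phi : Prop := mseq phi /\
  forall eps : R, 0 < eps -> exists psi,
    [/\ reach psi, good b psi & (N2 nu (fun x => (psi x - phi x)%R) < eps%:E)%E].

Lemma ecvg0_lt (u : nat -> \bar R) (eps : R) : (u @ \oo --> 0)%E -> 0 < eps ->
  exists n, (u n < eps%:E)%E.
Proof.
move=> u0 e0.
have nb : nbhs (0%E : \bar R) [set y | (y < eps%:E)%E].
  apply: open_nbhs_nbhs; split; last by rewrite /= lte_fin.
  exact: open_ereal_lt_ereal.
by have [n _ h] := u0 _ nb; exists n; exact: (h n (leqnn n)).
Qed.
End Approximation.

(** * Tensor products as limits of cell sums *)

Section CellSum.
Variables (R : realType) (nu : probability R R) (M : R).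
Hypotheses (nuM : nu [set s | M < `|s|] = 0%E) (M0 : 0 <= M).
Local Notation inBox := (@inBox R M).
Local Notation good := (@good R M).
Implicit Types phi psi : seq (R * R) -> R.

Lemma good_le b b' phi : b <= b' -> good b phi -> good b' phi.
Proof.
move=> bb' [mphi bphi belphi sphi]; split=> // x xB x0 b'x.
by apply: belphi => //; exact: le_trans b'x.
Qed.

Section OneStep.
Variables (al be : R) (psi : seq (R * R) -> R) (k : nat).
Hypotheses (al0 : 0 <= al) (alLbe : al <= be).
Hypotheses (rpsi : reach nu psi) (gpsi : good al psi).

(** The power is [k.+1] because one factor creates the new particle and the other [k] multiply by
    its mark. *)
Definition cell_sum N x : R :=
  \sum_(i < N.+1) cterm nu (cut al be N i) (cut al be N i.+1) psi k.+1 x.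

Let mpsi : mseq psi := good_mseq gpsi.
Let psi_below := good_below gpsi.
Let cut_ge0 N i : 0 <= cut al be N i.
Proof. by rewrite (le_trans al0)// -{1}(cut0 al be N) cut_le. Qed.
Let cut_ge N i : al <= cut al be N i.
Proof. by rewrite -{1}(cut0 al be N) cut_le. Qed.
Let cut_leS N i : cut al be N i <= cut al be N i.+1.
Proof. exact: cut_le. Qed.
Let cell_size N i : cut al be N i.+1 - cut al be N i = (be - al) / N.+1%:R.
Proof. by rewrite cutS addrAC subrr add0r. Qed.
Let cell_le N i : cut al be N i.+1 - cut al be N i <= be - al.
Proof.
by rewrite cell_size ler_pdivrMr ?ltr0n// ler_peMr ?subr_ge0// ler1n.
Qed.

Lemma reach_cell_sum N : reach nu (cell_sum N).
Proof.
apply: (reach_sum (phi := fun i => cterm nu (cut al be N i) (cut al be N i.+1) psi k.+1)).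
by move=> i _; exact: reach_cterm.
Qed.

Lemma mseq_cell_sum N : mseq (cell_sum N).
Proof.
by apply: mseq_sum => i; exact: mseq_cterm.
Qed.

Lemma cell_sum_nil N : cell_sum N [::] = 0.
Proof.
rewrite /cell_sum big1// => i _.
exact: (cterm_nil nuM M0 (cut_ge0 N i) (cut_leS N i) (cut_ge N i) mpsi psi_below).
Qed.

Lemma cell_sum_out N p y : inBox (p :: y) -> ~~ (al <= p.1 < be) ->
  cell_sum N (p :: y) = 0.
Proof.
move=> xB pc; rewrite /cell_sum big1// => i _.
apply: (cterm_out nuM M0 (cut_ge0 N i) (cut_leS N i) (cut_ge N i) mpsi psi_below) => //.
apply: contra pc => /andP[ip pi]; rewrite (le_trans (cut_ge N i) ip)/=.
apply: (lt_le_trans pi); rewrite -[leRHS](cut_last al be N); exact: cut_le.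
Qed.

Lemma cell_sum_in N p y : inBox (p :: y) -> al <= p.1 < be ->
  exists2 i : 'I_N.+1, cut al be N i <= p.1 < cut al be N i.+1 &
    cell_sum N (p :: y) =
    cterm nu (cut al be N i) (cut al be N i.+1) psi k.+1 (p :: y).
Proof.
move=> xB pc; have [i ip ni] := cut_exists alLbe N pc; exists i => //.
rewrite /cell_sum (bigD1 i)//= big1 ?addr0// => j ji.
apply: (cterm_out nuM M0 (cut_ge0 N j) (cut_leS N j) (cut_ge N j) mpsi psi_below) => //.
exact: ni.
Qed.

(** At most one cell contributes at a given configuration, so the bound does not grow with [N]. *)
Lemma cell_sum_bound C : (forall x, inBox x -> `|psi x| <= C) ->
  forall N x, inBox x -> `|cell_sum N x| <= (1 + M + (be - al)) ^+ k.+1 * C.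
Proof.
move=> psiC N x xB; have C0 : 0 <= C by apply: le_trans (psiC x xB).
have K0 : 0 <= (1 + M + (be - al)) ^+ k.+1 * C.
  by apply: mulr_ge0 => //; apply: exprn_ge0; apply: addr_ge0; rewrite ?subr_ge0// addr_ge0.
case: x xB => [|p y] xB; first by rewrite cell_sum_nil normr0.
have [pc|pc] := boolP (al <= p.1 < be); last by rewrite cell_sum_out// normr0.
have [i _ ->] := cell_sum_in N xB pc.
exact: (cterm_bound nuM M0 (cut_ge0 N i) (cut_leS N i) (cut_ge N i) mpsi psi_below psiC).
Qed.

Lemma good_cell_sum N : good be (cell_sum N).
Proof.
have [C psiC] := good_bound gpsi; have [n psin] := good_size gpsi.
split.
- exact: mseq_cell_sum.
- by exists ((1 + M + (be - al)) ^+ k.+1 * C) => x; exact: cell_sum_bound.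
- move=> [|p y] xB // _; rewrite /tfirst /= => bep.
  by apply: cell_sum_out => //; rewrite negb_and -(leNgt be) bep orbT.
exists (n + k.+1)%N => x xB nx; rewrite /cell_sum big1// => i _.
exact: (cterm_size nuM M0 (cut_ge0 N i) (cut_leS N i) (cut_ge N i) mpsi psi_below psin).
Qed.

Lemma tens_bound C x : (forall x, inBox x -> `|psi x| <= C) -> inBox x ->
  `|tens k al be psi x| <= M ^+ k * C.
Proof.
move=> psiC xB; have C0 : 0 <= C by apply: le_trans (psiC x xB).
case: x xB => [|p y] xB /=; first by rewrite normr0 mulr_ge0// exprn_ge0.
move: (xB); rewrite inBox_cons => /and3P[_ pM yB].
rewrite normrM ler_pM ?psiC// normrM -[leRHS]mul1r ler_pM ?ico_le1//.
by rewrite normrX lerXn2r ?nnegrE.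
Qed.

(** Only the cell of the leading particle counts. Once the mesh is below the gap to the next time,
    [cterm_target] applies with an error proportional to the mesh. *)
Lemma cell_sum_cvg x : inBox x -> sorted (fun a b : R * R => b.1 < a.1) x ->
  cell_sum N x - tens k al be psi x @[N --> \oo] --> 0.
Proof.
have [C psiC] := good_bound gpsi.
case: x => [|p y] xB xs.
  rewrite (_ : (fun _ => _) = cst 0); first exact: cvg_cst.
  by apply/funext => N; rewrite cell_sum_nil subrr.
have [pc|pc] := boolP (al <= p.1 < be); last first.
  rewrite (_ : (fun _ => _) = cst 0); first exact: cvg_cst.
  apply/funext => N; rewrite cell_sum_out//= /ico.
  by rewrite (negbTE pc) !mul0r subrr.
have C0 : 0 <= C by apply: le_trans (psiC _ xB).
pose E := rho_err M (be - al) k.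
have EC0 : E * ((be - al) / N.+1%:R) * C @[N --> \oo] --> (0 : R).
  rewrite [X in _ --> X](_ : _ = E * 0 * C); last by rewrite mulr0 mul0r.
  by apply: cvgMl; apply: cvgMr; exact: cvg_cell_size.
apply/cvgr0Pnorm_le => e e0.
have below := eventually_below_cell alLbe xs.
move/cvgr0Pnorm_le : EC0 => /(_ _ e0) small.
near=> N.
have [i /[dup] ip /andP[ip1 ip2] ->] := cell_sum_in N xB pc.
have yi : (y == [::]) || (tfirst y < cut al be N i).
  (* The index of the cell depends on [N], so it is generalized before passing to the uniform
     eventual statement. *)
  by move: (nat_of_ord i) ip2; near: N.
have := cterm_target nuM M0 (cut_ge0 N i) (cut_leS N i) (cut_ge N i) mpsi
  psi_below psiC k (cell_le N i) xB ip yi.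
rewrite /= (_ : ico al be p.1 = 1) ?mul1r; last by rewrite /ico pc.
move=> /le_trans; apply.
rewrite cell_size; apply: le_trans (ler_norm _) _; near: N; exact: small.
Unshelve. all: by end_near. Qed.

Lemma N2_cell_sum_cvg :
  (N2 nu (fun x => (cell_sum N x - tens k al be psi x)%R) @[N --> \oo] --> 0)%E.
Proof.
have [C psiC] := good_bound gpsi; have [n psin] := good_size gpsi.
apply: (@N2_bounded_cvg0 _ _ _ nuM _
  ((1 + M + (be - al)) ^+ k.+1 * C + M ^+ k * C) be (n + k.+1)).
- by move=> N; apply: mseqB; [exact: mseq_cell_sum|exact: mseq_tens].
- move=> N x xB; apply: (le_trans (ler_normB _ _)).
  by apply: lerD; [exact: cell_sum_bound|exact: tens_bound].
- move=> N [|p y] xB; first by rewrite cell_sum_nil subrr.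
  rewrite /tfirst /= => bep.
  have pc : (al <= p.1 < be) = false by rewrite (le_gtF (ltW bep)) andbF.
  by rewrite cell_sum_out ?pc// /ico pc !mul0r subrr.
- move=> N x xB nx; rewrite /cell_sum big1 => [|i _]; last first.
    exact: (cterm_size nuM M0 (cut_ge0 N i) (cut_leS N i) (cut_ge N i) mpsi psi_below psin).
  case: x xB nx => [|p y] xB nx /=; first by rewrite subrr.
  rewrite psin ?mulr0 ?subrr//; first by move: xB; rewrite inBox_cons => /and3P[].
  by move: nx => /=; lia.
- exact: cell_sum_cvg.
Qed.

End OneStep.

(** Two approximations in a row: [phi] by a good [psi], with the error controlled by [N2_tens], then
    the tensor of [psi] by cell sums. *)
Lemma appr_tens k al be phi : 0 <= al -> al <= be -> appr nu M al phi ->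
  appr nu M be (tens k al be phi).
Proof.
move=> al0 alLbe [mphi aphi]; split; first exact: mseq_tens.
move=> eps e0.
pose K := (be - al) * (M ^+ k) ^+ 2.
have K0 : 0 <= K by rewrite mulr_ge0 ?subr_ge0// sqr_ge0.
(* [K + 1] guards against [K = 0]. The errors enter the triangle inequality as
   $2\cdot\varepsilon/8+2\cdot\varepsilon/4<\varepsilon$. *)
have e1 : 0 < eps / (4 * (K + 1)).
  by rewrite divr_gt0// mulr_gt0// ltr_wpDl.
have [psi [rpsi gpsi psiphi]] := aphi _ e1.
have e2 : 0 < eps / 8 by rewrite divr_gt0.
have [N GN] := ecvg0_lt (N2_cell_sum_cvg k al0 alLbe gpsi) e2.
exists (cell_sum al be psi k N); split.
- exact: reach_cell_sum.
- exact: good_cell_sum.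
have mpsi := good_mseq gpsi.
have mG : mseq (cell_sum al be psi k N) by exact: mseq_cell_sum.
have tri := N2_triangle nu mG (mseq_tens k al be mpsi) (mseq_tens k al be mphi).
apply: (le_lt_trans tri).
have tB : (N2 nu (fun x => (tens k al be psi x - tens k al be phi x)%R) <= (eps / 4)%:E)%E.
  rewrite [X in N2 _ X](_ : _ = tens k al be (fun x => psi x - phi x)); last first.
    by apply/funext => -[|p y] /=; rewrite ?subrr// mulrBr.
  apply: le_trans (N2_tens nuM M0 k alLbe (mseqB mpsi mphi)) _.
  apply: (@le_trans _ _ (K%:E * (eps / (4 * (K + 1)))%:E)%E).
    by apply: lee_wpmul2l; [rewrite lee_fin|exact: ltW].
  rewrite -EFinM lee_fin ler_pdivlMr//.
  rewrite (_ : K * (eps / (4 * (K + 1))) * 4 = eps * (K / (K + 1))); last first.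
    by field; rewrite gt_eqF// ltr_wpDl.
  by rewrite ler_piMr ?(ltW e0)// ler_pdivrMr ?mul1r ?lerDl// ltr_wpDl.
apply: (@le_lt_trans _ _ (2%:E * (eps / 8)%:E + 2%:E * (eps / 4)%:E)%E).
  by apply: leeD; apply: lee_wpmul2l => //; exact: ltW.
by rewrite -!EFinM -EFinD lte_fin; lra.
Qed.

End CellSum.

(** * The closed span of products and its multipliers *)

Section ApproximableVectors.
Variables (R : realType) (nu : probability R R) (M : R).
Hypotheses (nuM : nu [set s | M < `|s|] = 0%E) (M0 : 0 <= M).
Local Notation inBox := (@inBox R M).
Local Notation N2 := (@N2 R nu).
Implicit Types phi psi m : seq (R * R) -> R.

(* The closed span of the products [1_{A_1}(t_1) s_1^{k_1} ... 1_{A_n}(t_n) s_n^{k_n}]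
   over decreasing intervals [A_1 > ... > A_n] below [b]. *)
Inductive prodspan : R -> nat -> (seq (R * R) -> R) -> Prop :=
| prodspan_vac : prodspan 0 0 (@vac R)
| prodspan_tens k al be n phi : 0 <= al -> al <= be -> prodspan al n phi ->
    prodspan be n.+1 (tens k al be phi)
| prodspan_add b n phi psi : prodspan b n phi -> prodspan b n psi ->
    prodspan b n (fun x => phi x + psi x)
| prodspan_scale b n c phi : prodspan b n phi -> prodspan b n (fun x => c * phi x)
| prodspan_le b b' n phi : b <= b' -> prodspan b n phi -> prodspan b' n phi
| prodspan_lim b n (psi : nat -> seq (R * R) -> R) phi :
    mseq phi -> (forall x, size x != n -> phi x = 0) ->
    (forall N, prodspan b n (psi N)) ->
    (N2 (fun x => (psi N x - phi x)%R) @[N --> \oo] --> 0)%E ->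
    prodspan b n phi.

Lemma prodspan_size b n phi : prodspan b n phi ->
  forall x, size x != n -> phi x = 0.
Proof.
elim=> {b n phi}.
- by case.
- move=> k al be n phi _ _ _ IH [|p y] //= yn.
  by rewrite IH ?mulr0// -eqSS.
- by move=> b n phi psi _ IH1 _ IH2 x xn; rewrite IH1// IH2// addr0.
- by move=> b n c phi _ IH x xn; rewrite IH// mulr0.
- by [].
- by [].
Qed.

Lemma prodspan_mseq b n phi : prodspan b n phi -> mseq phi.
Proof.
elim=> {b n phi} //.
- exact: mseq_vac.
- by move=> k al be n phi _ _ _ IH; exact: mseq_tens.
- by move=> b n phi psi _ IH1 _ IH2; exact: mseqD.
- by move=> b n c phi _ IH; exact: mseqZ.
Qed.

Lemma N2_eq0_sub phi psi : (forall x, in_S x -> phi x = psi x) ->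
  N2 (fun x => phi x - psi x) = 0%E.
Proof. by move=> e; apply: N20 => x xS; rewrite e// subrr. Qed.

Lemma goodD b phi psi : good M b phi -> good M b psi ->
  good M b (fun x => phi x + psi x).
Proof.
move=> [m1 [C1 b1] v1 [n1 s1]] [m2 [C2 b2] v2 [n2 s2]]; split.
- exact: mseqD.
- by exists (C1 + C2) => x xB; apply: (le_trans (ler_normD _ _)); rewrite lerD ?b1 ?b2.
- by move=> x xB x0 bx; rewrite v1// v2// addr0.
- exists (maxn n1 n2) => x xB; rewrite gtn_max => /andP[n1x n2x].
  by rewrite s1// s2// addr0.
Qed.

Lemma goodZ b c phi : good M b phi -> good M b (fun x => c * phi x).
Proof.
move=> [m1 [C1 b1] v1 [n1 s1]]; split.
- exact: mseqZ.
- by exists (`|c| * C1) => x xB; rewrite normrM ler_wpM2l// b1.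
- by move=> x xB x0 bx; rewrite v1// mulr0.
- by exists n1 => x xB n1x; rewrite s1// mulr0.
Qed.

Lemma good_vac b : good M b (@vac R).
Proof.
split.
- exact: mseq_vac.
- by exists 1 => x _; rewrite /vac; case: nilp; rewrite ?normr1 ?normr0.
- by case.
- by exists 0%N; case.
Qed.

(** Induction on the construction: [appr_tens] handles a new leading particle, and a limit is
    approximated through approximants of its terms. *)
Lemma prodspan_appr b n phi : prodspan b n phi -> appr nu M b phi.
Proof.
elim=> {b n phi}.
- split; first exact: mseq_vac.
  move=> eps e0; exists (@vac R); split; [exact: reach_vac|exact: good_vac|].
  by rewrite N2_eq0_sub// lte_fin.
- by move=> k al be n phi al0 alLbe _ IH; exact: appr_tens.
- move=> b n phi psi _ [m1 IH1] _ [m2 IH2]; split; first exact: mseqD.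
  move=> eps e0; have e8 : 0 < eps / 8 by rewrite divr_gt0.
  have [p1 [r1 g1 d1]] := IH1 _ e8; have [p2 [r2 g2 d2]] := IH2 _ e8.
  exists (fun x => p1 x + p2 x); split; [exact: reachD|exact: goodD|].
  rewrite [X in N2 X](_ : _ = fun x => (p1 x - phi x) + (p2 x - psi x)); last first.
    by apply/funext => x; rewrite opprD addrACA.
  apply: (le_lt_trans (N2D nu (mseqB (good_mseq g1) m1) (mseqB (good_mseq g2) m2))).
  apply: (@le_lt_trans _ _ (2%:E * (eps / 8)%:E + 2%:E * (eps / 8)%:E)%E).
    by apply: leeD; apply: lee_wpmul2l => //; exact: ltW.
  by rewrite -!EFinM -EFinD lte_fin; lra.
- move=> b n c phi _ [m1 IH1]; split; first exact: mseqZ.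
  move=> eps e0.
  have c1 : 0 < c ^+ 2 + 1 by rewrite ltr_wpDl// sqr_ge0.
  have [p1 [r1 g1 d1]] := IH1 _ (divr_gt0 e0 c1).
  exists (fun x => c * p1 x); split; [exact: reachZ|exact: goodZ|].
  rewrite [X in N2 X](_ : _ = fun x => c * (p1 x - phi x)); last first.
    by apply/funext => x; rewrite mulrBr.
  rewrite (N2Z nu c (mseqB (good_mseq g1) m1)).
  apply: (@le_lt_trans _ _ ((c ^+ 2)%:E * (eps / (c ^+ 2 + 1))%:E)%E).
    by apply: lee_wpmul2l; [rewrite lee_fin sqr_ge0|exact: ltW].
  by rewrite -EFinM lte_fin mulrA ltr_pdivrMr// mulrC ltr_pM2l// ltrDl.
- move=> b b' n phi bb' _ [m1 IH]; split=> // eps e0.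
  by have [p [r g d]] := IH _ e0; exists p; split=> //; exact: good_le g.
- move=> b n psi phi mphi _ _ IH cv; split=> // eps e0.
  have e8 : 0 < eps / 8 by rewrite divr_gt0.
  have [N dN] := ecvg0_lt cv e8.
  have [mN IHN] := IH N; have [p [r g d]] := IHN _ e8.
  exists p; split=> //.
  apply: (le_lt_trans (N2_triangle nu (good_mseq g) mN mphi)).
  apply: (@le_lt_trans _ _ (2%:E * (eps / 8)%:E + 2%:E * (eps / 8)%:E)%E).
    by apply: leeD; apply: lee_wpmul2l => //; exact: ltW.
  by rewrite -!EFinM -EFinD lte_fin; lra.
Qed.

Lemma good_lty b phi : good M b phi -> (N2 phi < +oo)%E.
Proof.
move=> [m1 [C1 b1] v1 [n1 s1]].
apply: (@N2_bounded_lty _ _ _ nuM phi C1 (Num.max b 0) n1) => //.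
move=> x xB; rewrite gt_max => /andP[bx x0]; apply: v1 => //; last exact: ltW.
by apply: contraTneq x0 => ->; rewrite /tfirst /= ltxx.
Qed.

(** The vector is within finite distance of a good one, which is bounded with support in a box. *)
Lemma prodspan_lty b n phi : prodspan b n phi -> (N2 phi < +oo)%E.
Proof.
move=> D; have [mphi aphi] := prodspan_appr D.
have [psi [_ g d]] := aphi 1 ltr01; have mpsi := good_mseq g.
have -> : N2 phi = N2 (fun x => (phi x - psi x) + psi x).
  by congr N2; apply/funext => x; rewrite subrK.
apply: (le_lt_trans (N2D nu (mseqB mphi mpsi) mpsi)).
rewrite lte_add_pinfty// lte_mul_pinfty//; last exact: good_lty g.
by rewrite N2_sub (lt_trans d)// ltry.
Qed.

(** Stability is asked for every [b] and every vector of the $n$-particle span at once, so that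
    multipliers compose and form an algebra. *)
Definition multiplier n m : Prop :=
  forall b phi, prodspan b n phi -> prodspan b n (fun x => m x * phi x).

Lemma cvg_N2_mul m C (psi : nat -> seq (R * R) -> R) phi : mseq m ->
  (forall N, mseq (psi N)) -> mseq phi ->
  (forall x, inBox x -> `|m x| <= C) ->
  (N2 (fun x => (psi N x - phi x)%R) @[N --> \oo] --> 0)%E ->
  (N2 (fun x => (m x * psi N x - m x * phi x)%R) @[N --> \oo] --> 0)%E.
Proof.
move=> mm mpsi mphi mC cv.
have h N : (N2 (fun x => (m x * psi N x - m x * phi x)%R) <=
    (C ^+ 2)%:E * N2 (fun x => (psi N x - phi x)%R))%E.
  apply: (le_N2 nuM) => [||x xB].
  - by apply: mseqB; exact: mseqM.
  - exact: mseqB.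
  by rewrite -mulrBr normrM ler_wpM2r// mC.
apply: (@squeeze_cvge _ _ _ _ (fun=> 0%E) _
   (fun N => ((C ^+ 2)%:E * N2 (fun x => (psi N x - phi x)%R))%E)).
- by apply: nearW => N; rewrite N2_ge0 h.
- exact: cvg_cst.
- by rewrite -(mule0 (C ^+ 2)%:E); apply: cvgeZl.
Qed.

Lemma mseq_nth1 j : mseq (fun x : seq (R * R) => (nth (0, 0) x j).1).
Proof. by move=> n; apply: (measurableT_comp measurable_fst); exact: mseq_nth. Qed.

Lemma mseq_nth2 j : mseq (fun x : seq (R * R) => (nth (0, 0) x j).2).
Proof. by move=> n; apply: (measurableT_comp measurable_snd); exact: mseq_nth. Qed.

Lemma mseq_lt c phi : mseq phi -> mseq (fun x => (phi x < c)%R%:R : R).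
Proof.
move=> mphi; apply: mseq_natr => n; apply: measurable_fun_ltr.
  exact: mphi.
exact: measurable_cst.
Qed.

(** On a product, the factor just shortens the interval of the [j]-th particle; sums and limits
    follow because the factor is bounded by 1. *)
Lemma multiplier_time_lt n j (c : R) :
  multiplier n (fun x => ((nth (0, 0) x j).1 < c)%R%:R).
Proof.
move=> b phi D; elim: D j => {b n phi}.
- move=> j; rewrite (_ : (fun _ => _) =
      fun x => ((nth (0, 0) ([::] : seq (R * R)) j).1 < c)%R%:R * vac x); last first.
    by apply/funext => -[|p x] //; rewrite /vac !mulr0.
  by apply: prodspan_scale; exact: prodspan_vac.
- move=> k al be n phi al0 alLbe D IH [|j].
    (* The maximum with [al] keeps the interval well formed, and empty, when [c] lies to the left of
       it. *)
    pose be' := Num.max al (Num.min be c).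
    have albe' : al <= be' by rewrite le_max lexx.
    have be'be : be' <= be by rewrite ge_max alLbe ge_min lexx.
    rewrite (_ : (fun _ => _) = tens k al be' phi).
      by apply: (prodspan_le be'be); exact: prodspan_tens.
    apply/funext => -[|p y] /=; first by rewrite mulr0.
    rewrite !mulrA; congr (_ * _ * _); rewrite /ico -natrM mulnb; congr (_%:R).
    have [alp|] := leP al p.1; last by rewrite andbF.
    by rewrite /be' lt_max ltNge alp lt_min /= andbC.
  rewrite (_ : (fun _ => _) = tens k al be
      (fun x => ((nth (0, 0) x j).1 < c)%R%:R * phi x)).
    by apply: prodspan_tens => //; exact: IH.
  by apply/funext => -[|p y] /=; rewrite ?mulr0// mulrCA.
- move=> b n phi psi _ IH1 _ IH2 j; under eq_fun do rewrite mulrDr.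
  by apply: prodspan_add; [exact: IH1|exact: IH2].
- move=> b n a phi _ IH j; under eq_fun do rewrite mulrCA.
  by apply: prodspan_scale; exact: IH.
- by move=> b b' n phi bb' _ IH j; apply: (prodspan_le bb'); exact: IH.
- move=> b n psi phi mphi phin D IH cv j.
  have ml := mseq_lt c (mseq_nth1 j).
  apply: (prodspan_lim (mseqM ml mphi) _ (fun N => IH N j)).
    by move=> x xn; rewrite phin// mulr0.
  apply: (cvg_N2_mul (C := 1) ml (fun N => prodspan_mseq (D N)) mphi _ cv).
  by move=> x _; case: (_ < _); rewrite ?normr1 ?normr0.
Qed.

Lemma nth2_bound x j : inBox x -> `|(nth (0, 0) x j).2| <= M.
Proof.
move=> /andP[_ /allP xM]; have [jx|xj] := ltnP j (size x).
  by apply: xM; exact: mem_nth.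
by rewrite nth_default// normr0.
Qed.

(** On a product it raises the exponent of the [j]-th mark by one; it passes to limits because marks
    are bounded by [M] on the essential domain. *)
Lemma multiplier_mark n j : multiplier n (fun x => (nth (0, 0) x j).2).
Proof.
move=> b phi D; elim: D j => {b n phi}.
- move=> j; rewrite (_ : (fun _ => _) =
      fun x => (nth (0, 0) ([::] : seq (R * R)) j).2 * vac x); last first.
    by apply/funext => -[|p x] //; rewrite /vac !mulr0.
  by apply: prodspan_scale; exact: prodspan_vac.
- move=> k al be n phi al0 alLbe D IH [|j].
    rewrite (_ : (fun _ => _) = tens k.+1 al be phi); first exact: prodspan_tens.
    apply/funext => -[|p y] /=; first by rewrite mulr0.
    by rewrite exprS; ring.
  rewrite (_ : (fun _ => _) = tens k al be (fun x => (nth (0, 0) x j).2 * phi x)).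
    by apply: prodspan_tens => //; exact: IH.
  by apply/funext => -[|p y] /=; rewrite ?mulr0// mulrCA.
- move=> b n phi psi _ IH1 _ IH2 j; under eq_fun do rewrite mulrDr.
  by apply: prodspan_add; [exact: IH1|exact: IH2].
- move=> b n a phi _ IH j; under eq_fun do rewrite mulrCA.
  by apply: prodspan_scale; exact: IH.
- by move=> b b' n phi bb' _ IH j; apply: (prodspan_le bb'); exact: IH.
- move=> b n psi phi mphi phin D IH cv j.
  have ml := mseq_nth2 j.
  apply: (prodspan_lim (mseqM ml mphi) _ (fun N => IH N j)).
    by move=> x xn; rewrite phin// mulr0.
  apply: (cvg_N2_mul (C := M) ml (fun N => prodspan_mseq (D N)) mphi _ cv).
  by move=> x xB; exact: nth2_bound.
Qed.

Lemma multiplierM n m m' : multiplier n m -> multiplier n m' ->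
  multiplier n (fun x => m x * m' x).
Proof.
move=> h h' b phi D; rewrite (_ : (fun _ => _) = fun x => m x * (m' x * phi x)).
  by apply: h; exact: h'.
by apply/funext => x; rewrite mulrA.
Qed.

Lemma multiplierD n m m' : multiplier n m -> multiplier n m' ->
  multiplier n (fun x => m x + m' x).
Proof.
move=> h h' b phi D; under eq_fun do rewrite mulrDl.
by apply: prodspan_add; [exact: h|exact: h'].
Qed.

Lemma multiplier_cst n c : multiplier n (fun=> c).
Proof. by move=> b phi D; exact: prodspan_scale. Qed.

Lemma multiplierZ n c m : multiplier n m -> multiplier n (fun x => c * m x).
Proof. by move=> h; apply: multiplierM => //; exact: multiplier_cst. Qed.

Lemma multiplierX n m i : multiplier n m -> multiplier n (fun x => m x ^+ i).
Proof.
move=> h; elim: i => [|i IH]; first exact: multiplier_cst.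
by under eq_fun do rewrite exprS; exact: multiplierM.
Qed.

(** The differences are dominated by [2 * C * |phi|], of finite norm by [prodspan_lty], and the span
    is closed under norm limits. *)
Lemma multiplier_lim n (g : nat -> seq (R * R) -> R) m C :
  (forall N, mseq (g N)) -> mseq m -> (forall N, multiplier n (g N)) ->
  (forall N x, inBox x -> `|g N x| <= C) -> (forall x, inBox x -> `|m x| <= C) ->
  (forall x, inBox x -> size x = n -> g N x @[N --> \oo] --> m x) ->
  multiplier n m.
Proof.
move=> mg mm hg gC mC gm b phi D.
have mphi := prodspan_mseq D; have phin := prodspan_size D.
apply: (@prodspan_lim _ _ (fun N x => g N x * phi x)).
- exact: mseqM.
- by move=> x xn; rewrite phin// mulr0.
- by move=> N; exact: hg.
have C0 : 0 <= C by apply: le_trans (mC [::] isT).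
apply: (N2_dominated_cvg0 nuM (G := fun x => (C + C) * phi x) (n0 := n)).
- by move=> N; apply: mseqB; exact: mseqM.
- exact: mseqZ.
- move=> N x xB; rewrite -mulrBl !normrM ler_wpM2r//.
  rewrite [leRHS]ger0_norm ?addr_ge0//.
  by apply: (le_trans (ler_normB _ _)); rewrite lerD ?gC ?mC.
- move=> x xB _; have [xn|xn] := eqVneq (size x) n; last first.
    rewrite (_ : (fun _ => _) = cst 0); first exact: cvg_cst.
    by apply/funext => N; rewrite phin// !mulr0 subrr.
  have gmx := gm x xB xn.
  rewrite (_ : 0 = m x * phi x - m x * phi x); last by rewrite subrr.
  by apply: cvgB; [exact: cvgMl|exact: cvg_cst].
- rewrite N2Z// lte_mul_pinfty ?lee_fin ?sqr_ge0//.
  exact: prodspan_lty D.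
- by move=> N x _ nx; rewrite phin ?mulr0 ?subrr// gtn_eqF.
Qed.

Lemma bernoulli_ge (u : R) N : 0 <= u -> 1 + N%:R * u <= (1 + u) ^+ N.
Proof.
move=> u0; elim: N => [|N IH]; first by rewrite mul0r addr0 expr0.
rewrite exprSr; apply: (@le_trans _ _ ((1 + N%:R * u) * (1 + u))).
  have h : 0 <= N%:R * u * u by do 2 apply: mulr_ge0 => //.
  by rewrite -natr1; move: h; set a : R := N%:R; nra.
by rewrite ler_wpM2r ?addr_ge0.
Qed.

Lemma bernoulli_le (u : R) N : 0 <= u <= 1 -> 1 - N%:R * u <= (1 - u) ^+ N.
Proof.
move=> /andP[u0 u1]; elim: N => [|N IH]; first by rewrite mul0r subr0 expr0.
rewrite exprSr; apply: (@le_trans _ _ ((1 - N%:R * u) * (1 - u))).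
  have h : 0 <= N%:R * u * u by do 2 apply: mulr_ge0 => //.
  by rewrite -natr1; move: h; set a : R := N%:R; nra.
by rewrite ler_wpM2r ?subr_ge0.
Qed.

(** Write $r=q^2$. Bernoulli for $2-q=1+(1-q)$ and $q(2-q)\le1$ give $Nq^N\le1/(1-q)$; the other
    factor $q^N$ tends to 0. *)
Lemma cvg_mulrn_expr (r : R) : 0 <= r < 1 -> N%:R * r ^+ N @[N --> \oo] --> (0 : R).
Proof.
move=> /andP[r0 r1]; pose q := Num.sqrt r.
have q0 : 0 <= q by exact: sqrtr_ge0.
have q1 : q < 1 by rewrite -sqrtr1 ltr_sqrt.
have rq : r = q * q by rewrite -expr2 sqr_sqrtr.
have bnd N : N%:R * q ^+ N <= (1 - q)^-1.
  have d0 : 0 < 1 - q by rewrite subr_gt0.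
  have := @bernoulli_ge (1 - q) N (ltW d0) => h.
  have h1 : ((1 + (1 - q)) * q) ^+ N <= 1.
    by apply: exprn_ile1; nra.
  have qN : 0 <= q ^+ N by exact: exprn_ge0.
  rewrite -[leRHS]mul1r ler_pdivlMr//.
  apply: le_trans h1; rewrite exprMn.
  apply: (@le_trans _ _ ((1 + N%:R * (1 - q)) * q ^+ N)); last by rewrite ler_wpM2r.
  by nra.
apply: (@squeeze_cvgr _ _ _ _ (fun=> 0) (fun N => (1 - q)^-1 * q ^+ N)).
- apply: nearW => N; rewrite mulr_ge0 ?exprn_ge0//=.
  by rewrite rq exprMn mulrA ler_wpM2r ?exprn_ge0.
- exact: cvg_cst.
- rewrite -[X in _ --> X](mulr0 (1 - q)^-1); apply: cvgMr.
  by apply: cvg_expr; rewrite ger0_norm.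
Qed.

(* Polynomials in [y] converging on [0, 1] to the indicator of [y < 1/2]. *)
Definition cutoff N (y : R) : R := (1 - y ^+ N) ^+ (N * 2 ^ N).

Lemma cutoff_itv N y : 0 <= y <= 1 -> 0 <= cutoff N y <= 1.
Proof.
move=> /andP[y0 y1].
have yN0 : 0 <= y ^+ N by exact: exprn_ge0.
have yN1 : y ^+ N <= 1 by exact: exprn_ile1.
by rewrite /cutoff exprn_ge0 ?subr_ge0// exprn_ile1// ?subr_ge0// gerBl.
Qed.

(** Let $m=N2^N$, so $my^N=N(2y)^N$. For $y<1/2$ Bernoulli gives $(1-y^N)^m\ge1-N(2y)^N\to1$. For
    $y\ge1/2$, $(1-y^N)^m(1+y^N)^m\le1$ while $(1+y^N)^m\ge1+N(2y)^N\ge N+1$. *)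
Lemma cutoff_cvg y : 0 <= y <= 1 ->
  cutoff N y @[N --> \oo] --> ((y < 2^-1)%R%:R : R).
Proof.
move=> /[dup] y01 /andP[y0 y1].
have yN0 N : 0 <= y ^+ N by exact: exprn_ge0.
have yN1 N : y ^+ N <= 1 by exact: exprn_ile1.
have mN N : (N * 2 ^ N)%N%:R * y ^+ N = N%:R * (2 * y) ^+ N :> R.
  by rewrite natrM natrX exprMn mulrA.
have [yl|yg] := ltP y 2^-1.
  apply: (@squeeze_cvgr _ _ _ _ (fun N => 1 - N%:R * (2 * y) ^+ N) (fun=> 1)).
  - apply: nearW => N; have /andP[_ ->] := cutoff_itv N y01; rewrite andbT -mN.
    by apply: bernoulli_le; rewrite yN0 yN1.
  - rewrite -[X in _ --> X](subr0 1); apply: cvgB; first exact: cvg_cst.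
    by apply: cvg_mulrn_expr; lra.
  - exact: cvg_cst.
apply: (@squeeze_cvgr _ _ _ _ (fun=> 0) (fun N => N.+1%:R^-1)).
- apply: nearW => N; have /andP[-> _] := cutoff_itv N y01 => /=.
  have b1 := bernoulli_ge (N * 2 ^ N) (yN0 N).
  have b2 : N.+1%:R <= (1 + y ^+ N) ^+ (N * 2 ^ N).
    apply: le_trans b1; rewrite mN -natr1 addrC lerD2l ler_peMr//.
    by apply: exprn_ege1; lra.
  rewrite -[leRHS]mul1r ler_pdivlMr ?ltr0n//.
  apply: (@le_trans _ _ (cutoff N y * (1 + y ^+ N) ^+ (N * 2 ^ N))).
    by rewrite ler_wpM2l//; have /andP[] := cutoff_itv N y01.
  rewrite /cutoff -exprMn; apply: exprn_ile1; have := yN0 N; have := yN1 N; nra.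
- exact: cvg_cst.
- exact: cvg_harmonic.
Qed.

(** An affine map sends $[-M,M]$ into $[0,1]$ and [c] to $1/2$; the polynomials [cutoff] of it are
    multipliers and converge boundedly to the step. *)
Lemma multiplier_mark_lt n j (c : R) :
  multiplier n (fun x => ((nth (0, 0) x j).2 < c)%R%:R).
Proof.
(* Chosen so that $|(s-c)/L|\le1/2$ for every $|s|\le M$; the summand 1 keeps [L] positive. *)
pose L := 2 * (M + `|c| + 1).
have L0 : 0 < L by rewrite /L mulr_gt0// ltr_wpDl// addr_ge0.
pose aff (s : R) : R := 2^-1 + (s - c) / L.
have aff01 (s : R) : `|s| <= M -> 0 <= aff s <= 1.
  move=> sM.
  have : `|(s - c) / L| <= 2^-1.
    rewrite normrM normfV (gtr0_norm L0) ler_pdivrMr//.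
    by apply: (le_trans (ler_normB _ _)); rewrite /L; lra.
  by rewrite ler_norml /aff => /andP[]; lra.
have aff_lt s : (aff s < 2^-1) = (s < c).
  by rewrite /aff gtrDl pmulr_llt0 ?invr_gt0// subr_lt0.
have maff : mseq (fun x => aff (nth (0, 0) x j).2).
  apply: mseqD; first exact: mseq_cst.
  apply: mseqM; last exact: mseq_cst.
  by apply: mseqB; [exact: mseq_nth2|exact: mseq_cst].
have haff : multiplier n (fun x => aff (nth (0, 0) x j).2).
  apply: multiplierD; first exact: multiplier_cst.
  apply: multiplierM; last exact: multiplier_cst.
  by apply: multiplierD; [exact: multiplier_mark|exact: multiplier_cst].
have mX (phi : seq (R * R) -> R) i : mseq phi -> mseq (fun x => phi x ^+ i).
  by move=> mphi l; apply: measurable_funX; exact: mphi.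
apply: (@multiplier_lim n (fun N x => cutoff N (aff (nth (0, 0) x j).2)) _ 1).
- move=> N; apply: (mX _ _); apply: mseqB; first exact: mseq_cst.
  exact: mX.
- by apply: mseq_lt; exact: mseq_nth2.
- move=> N; apply: multiplierX; under eq_fun do rewrite -mulN1r.
  apply: multiplierD; first exact: multiplier_cst.
  by apply: multiplierZ; exact: multiplierX.
- move=> N x xB; have /andP[h0 h1] := cutoff_itv N (aff01 _ (nth2_bound j xB)).
  by rewrite ger0_norm.
- by move=> x _; case: (_ < _); rewrite ?normr1 ?normr0.
- by move=> x xB _; rewrite -aff_lt; exact: cutoff_cvg (aff01 _ (nth2_bound j xB)).
Qed.

End ApproximableVectors.

(** * From multipliers to all square-integrable vectors *)

Section Density.
Variables (R : realType) (nu : probability R R) (M : R).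
Hypotheses (nuM : nu [set s | M < `|s|] = 0%E) (M0 : 0 <= M).
Local Notation inBox := (@inBox R M).
Local Notation N2 := (@N2 R nu).
Local Notation prodspan := (@prodspan R nu).
Local Notation multiplier := (@multiplier R nu).
Implicit Types phi psi m : seq (R * R) -> R.

Definition lift n (f : n.-tuple (R * R) -> R) (x : seq (R * R)) : R :=
  if insub x is Some t then f t else 0.

Lemma lift_tuple n (f : n.-tuple (R * R) -> R) (t : n.-tuple (R * R)) :
  lift f t = f t.
Proof. by rewrite /lift valK. Qed.

Lemma lift_size n (f : n.-tuple (R * R) -> R) x : size x != n -> lift f x = 0.
Proof. by move=> xn; rewrite /lift insubN. Qed.

Lemma size_tupleP n (x : seq (R * R)) : size x = n ->
  exists t : n.-tuple (R * R), x = t.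
Proof. by move=> /eqP xn; exists (Tuple xn). Qed.

Lemma mseq_lift n (f : n.-tuple (R * R) -> R) : measurable_fun setT f -> mseq (lift f).
Proof.
move=> mf l; have [ln|ln] := eqVneq l n.
  subst l; rewrite (_ : (fun _ => _) = f) //.
  by apply/funext => x; rewrite lift_tuple.
rewrite (_ : (fun _ => _) = cst 0); first exact: measurable_cst.
by apply/funext => x; rewrite lift_size// size_tuple.
Qed.

(** Vectors of the $n$-particle span vanish on sequences of any other length, so the values of a
    multiplier there are irrelevant. *)
Lemma multiplier_ext n m m' : (forall t : n.-tuple (R * R), m t = m' t) ->
  multiplier n m -> multiplier n m'.
Proof.
move=> e h b phi D.
rewrite (_ : (fun _ => _) = fun x => m x * phi x); first exact: h.
apply/funext => x; have [/size_tupleP[t ->]|xn] := eqVneq (size x) n.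
  by rewrite e.
by rewrite (prodspan_size D xn) !mulr0.
Qed.

Lemma multiplier_sum n N (m : nat -> seq (R * R) -> R) :
  (forall i, (i < N)%N -> multiplier n (m i)) ->
  multiplier n (fun x => \sum_(i < N) m i x).
Proof.
elim: N => [|N IH] h.
  apply: (@multiplier_ext n (fun=> 0)); last exact: multiplier_cst.
  by move=> t; rewrite big_ord0.
apply: (@multiplier_ext n (fun x => \sum_(i < N) m i x + m N x)).
  by move=> t; rewrite big_ord_recr.
by apply: multiplierD; [apply: IH => i iN; apply: h; exact: ltnW|exact: h].
Qed.

Definition multset n : set (set (n.-tuple (R * R))) :=
  [set E | measurable E /\ multiplier n (lift (\1_E : _ -> R))].

Arguments multset : clear implicits.

(** Since multipliers form an algebra, complements come from $1-1_E$ and countable unions from the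
    bounded limits of $1-\prod_{i<N}(1-1_{E_i})$, with no disjointness required. *)
Lemma sigma_algebra_multset n : sigma_algebra setT (multset n).
Proof.
split.
- split; first exact: measurable0.
  apply: (@multiplier_ext n (fun=> 0)); last exact: multiplier_cst.
  by move=> t; rewrite lift_tuple indic0.
- move=> E [mE hE]; split; first exact: measurableD.
  apply: (@multiplier_ext n (fun x => 1 + -1 * lift (\1_E) x)).
    move=> t; rewrite !lift_tuple setTD !indicE in_setC.
    by case: (t \in E); rewrite /= ?mulr1 ?subrr ?mulr0 ?addr0.
  by apply: multiplierD; [exact: multiplier_cst|exact: multiplierZ].
move=> E hE; have mU : measurable (\bigcup_k E k).
  by apply: bigcup_measurable => k _; have [] := hE k.
split=> //.
pose g N x := 1 + -1 * \prod_(i < N) (1 + -1 * lift (\1_(E i)) x) : R.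
have mi (A : set (n.-tuple (R * R))) : measurable A -> mseq (lift (\1_A : _ -> R)).
  by move=> mA; apply: mseq_lift; exact: measurable_indic.
have b01 (A : set (n.-tuple (R * R))) x : {b : bool | lift (\1_A : _ -> R) x = b%:R}.
  rewrite /lift; case: insub => [t|]; last by exists false.
  by exists (t \in A); rewrite indicE.
have p01 N x : {b : bool | \prod_(i < N) (1 + -1 * lift (\1_(E i)) x) = b%:R :> R}.
  elim: N => [|N [b IH]]; first by exists true; rewrite big_ord0.
  rewrite big_ord_recr /= IH; have [c ->] := b01 (E N) x.
  exists (b && ~~ c); rewrite -mulnb natrM; congr (_ * _).
  by case: c; rewrite /= ?mulr1 ?subrr ?mulr0 ?addr0.
apply: (@multiplier_lim R nu M nuM M0 n g _ 1).
- move=> N l; apply: measurable_funD; first exact: measurable_cst.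
  apply: measurable_funM; first exact: measurable_cst.
  apply: measurable_prod => i _; apply: measurable_funD; first exact: measurable_cst.
  by apply: measurable_funM; [exact: measurable_cst|apply: (mi _ _); have [] := hE i].
- exact: mi.
- move=> N; apply: multiplierD; first exact: multiplier_cst.
  apply: multiplierZ; elim: N => [|N IH].
    apply: (@multiplier_ext n (fun=> 1)); last exact: multiplier_cst.
    by move=> t; rewrite big_ord0.
  apply: (@multiplier_ext n (fun x => \prod_(i < N) (1 + -1 * lift (\1_(E i)) x) *
      (1 + -1 * lift (\1_(E N)) x))).
    by move=> t; rewrite big_ord_recr.
  apply: multiplierM => //; apply: multiplierD; first exact: multiplier_cst.
  by apply: multiplierZ; have [] := hE N.
- move=> N x _; rewrite /g; have [b ->] := p01 N x.
  by case: b; rewrite ?mulr1 ?mulr0 ?addr0 ?subrr ?normr0 ?normr1.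
- by move=> x _; have [b ->] := b01 (\bigcup_k E k) x; case: b; rewrite ?normr0 ?normr1.
move=> x _ /size_tupleP[t ->]; rewrite lift_tuple indicE.
have [/set_mem[k _ Ekt]|tE] := boolP (t \in \bigcup_k E k).
  apply: cvg_near_cst; exists k.+1 => // N /= kN.
  rewrite /g (bigD1 (Ordinal kN))//= lift_tuple indicE mem_set// mulr1.
  by rewrite subrr mul0r mulr0 addr0.
apply: cvg_near_cst; apply: nearW => N; rewrite /g big1 ?mulr1 ?subrr// => i _.
rewrite lift_tuple indicE memNset ?mulr0 ?addr0// => Eit.
by move/negP: tE; apply; apply/mem_set; exists i.
Qed.

Lemma multset_preimage n (f : n.-tuple (R * R) -> R) :
  (forall c, multset n (f @^-1` `]-oo, c[)) ->
  forall B : set R, measurable B -> multset n (f @^-1` B).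
Proof.
move=> hf B mB.
suff : (measurable : set (set R)) `<=` image_set_system setT f (multset n).
  by move=> /(_ B mB); rewrite /image_set_system /= setTI.
have -> : (measurable : set (set R)) = <<s @RGenInftyO.G R >>.
  exact: RGenInftyO.measurableE.
apply: smallest_sub; first exact: sigma_algebra_image (sigma_algebra_multset n).
by move=> _ [c ->]; rewrite /image_set_system /= setTI; exact: hf.
Qed.

(** The tuple sigma-algebra is generated by the coordinates, that of pairs by the two projections,
    and Borel sets by rays, whose indicators are the multipliers [multiplier_time_lt] and
    [multiplier_mark_lt]. *)
Lemma measurable_multset n (E : set (n.-tuple (R * R))) : measurable E -> multset n E.
Proof.
have ray (g : n.-tuple (R * R) -> R) c : measurable_fun setT g ->
    multiplier n (fun x => lift (fun t => (g t < c)%R%:R) x) ->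
    multset n (g @^-1` `]-oo, c[).
  move=> mg hg; split.
    rewrite -[X in measurable X]setTI; apply: mg => //; exact: measurable_itv.
  apply: multiplier_ext hg => t; rewrite !lift_tuple indicE.
  rewrite (_ : (t \in _) = (g t < c))//.
  by apply/idP/idP; rewrite inE /= in_itv.
have m1 (i : 'I_n) : measurable_fun setT (fun t : n.-tuple (R * R) => (tnth t i).1).
  exact: (measurableT_comp measurable_fst (measurable_tnth i)).
have m2 (i : 'I_n) : measurable_fun setT (fun t : n.-tuple (R * R) => (tnth t i).2).
  exact: (measurableT_comp measurable_snd (measurable_tnth i)).
have h1 (i : 'I_n) (B : set R) : measurable B ->
    multset n [set t : n.-tuple (R * R) | B (tnth t i).1].
  apply: multset_preimage => c; apply: ray => //.
  apply: (@multiplier_ext n (fun x => ((nth (0, 0) x i).1 < c)%R%:R)).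
    by move=> t; rewrite lift_tuple (tnth_nth (0, 0)).
  exact: (multiplier_time_lt nuM).
have h2 (i : 'I_n) (B : set R) : measurable B ->
    multset n [set t : n.-tuple (R * R) | B (tnth t i).2].
  apply: multset_preimage => c; apply: ray => //.
  apply: (@multiplier_ext n (fun x => ((nth (0, 0) x i).2 < c)%R%:R)).
    by move=> t; rewrite lift_tuple (tnth_nth (0, 0)).
  exact: (multiplier_mark_lt nuM).
have h12 (i : 'I_n) (B : set (R * R)) : measurable B ->
    multset n [set t : n.-tuple (R * R) | B (tnth t i)].
  move=> mB; suff : (measurable : set (set (R * R))) `<=`
      image_set_system setT (fun t : n.-tuple (R * R) => tnth t i) (multset n).
    by move=> /(_ B mB); rewrite /image_set_system /= setTI.
  apply: smallest_sub; first exact: sigma_algebra_image (sigma_algebra_multset n).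
  move=> _ [] [C mC <-]; rewrite /image_set_system /= !setTI; [exact: h1|exact: h2].
move: E; apply: smallest_sub; first exact: sigma_algebra_multset.
move=> A; rewrite -bigcup_seq => -[i _ [C mC <-]]; rewrite setTI; exact: h12.
Qed.

(** The vector that multipliers are applied to: it stands for the constant 1 on $S_n$ with times
    below [a]. The [nilp] clause makes [base a 0] the vacuum even for [a = 0]. *)
Definition base (a : R) n (x : seq (R * R)) : R :=
  [&& size x == n, in_S x & nilp x || (tfirst x < a)]%R%:R.

Lemma mseq_base a n : mseq (base a n).
Proof.
apply: mseq_natr => l; apply: measurable_and.
  rewrite (_ : (fun _ => _) = cst (l == n)%N); first exact: measurable_cst.
  by apply/funext => x; rewrite size_tuple.
apply: measurable_and; first exact: mseq_in_S.
apply: measurable_or.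
  rewrite (_ : (fun _ => _) = cst (l == 0)%N); first exact: measurable_cst.
  by apply/funext => x; rewrite /nilp size_tuple.
by apply: measurable_fun_ltr; [exact: mseq_tfirst|exact: measurable_cst].
Qed.

Lemma base_bound a n x : `|base a n x| <= 1.
Proof. by rewrite /base; case: [&& _, _ & _]; rewrite ?normr1 ?normr0. Qed.

Lemma prodspan_sum b n N (phi : nat -> seq (R * R) -> R) :
  (forall i, (i <= N)%N -> prodspan b n (phi i)) ->
  prodspan b n (fun x => \sum_(i < N.+1) phi i x).
Proof.
elim: N => [|N IH] h.
  rewrite (_ : (fun _ => _) = phi 0%N); first exact: h.
  by apply/funext => x; rewrite big_ord1.
rewrite (_ : (fun _ => _) = fun x => \sum_(i < N.+1) phi i x + phi N.+1 x).
  by apply: prodspan_add; [apply: IH => i iN; apply: h; exact: leqW|exact: h].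
by apply/funext => x; rewrite big_ord_recr.
Qed.

(** Induction on [n]: sort by the cell of $t_1$ and require the other times to lie below the left
    end of that cell. The sum misses only configurations with $t_2$ in the cell of $t_1$, and each
    strictly decreasing configuration escapes this for a fine mesh. *)
Lemma prodspan_base a n : 0 <= a -> prodspan a n (base a n).
Proof.
elim: n a => [|n IH] a a0.
  rewrite (_ : base a 0 = @vac R); last by apply/funext => -[|p x].
  by apply: (prodspan_le a0); exact: prodspan_vac.
have cut_ge0 N i : 0 <= cut 0 a N i by rewrite -{1}(cut0 0 a N) cut_le.
have cut_leS N i : cut 0 a N i <= cut 0 a N i.+1 by exact: cut_le.
pose psi N x := \sum_(i < N.+1)
  tens 0 (cut 0 a N i) (cut 0 a N i.+1) (base (cut 0 a N i) n) x.
have psi_nil N : psi N [::] = 0 by rewrite /psi big1.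
have psi_in N p y : 0 <= p.1 < a -> exists2 i : 'I_N.+1,
    cut 0 a N i <= p.1 < cut 0 a N i.+1 & psi N (p :: y) = base (cut 0 a N i) n y.
  move=> pa; have [i ip ni] := cut_exists a0 N pa; exists i => //.
  rewrite /psi (bigD1 i)//= big1 ?addr0 => [|j /ni jp].
    by rewrite /ico ip expr0 !mul1r.
  by rewrite /ico (negbTE jp) !mul0r.
have psi_out N p y : a <= p.1 -> psi N (p :: y) = 0.
  move=> ap; rewrite /psi big1// => i _ /=; rewrite /ico.
  have /le_trans/(_ ap) : cut 0 a N i.+1 <= a.
    by rewrite -[leRHS](cut_last 0 a N) cut_le.
  by move=> /le_gtF ->; rewrite andbF !mul0r.
have psi_bound N x : inBox x -> `|psi N x| <= 1.
  case: x => [|p y] xB; first by rewrite psi_nil normr0.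
  have p0 : 0 <= p.1 by have := in_S_tfirst (inBox_S xB).
  have [pa|ap] := ltP p.1 a; last by rewrite psi_out// normr0.
  have [|i _ ->] := psi_in N p y; first by rewrite p0 pa.
  exact: base_bound.
have mpsi N : mseq (psi N).
  by apply: mseq_sum => i; apply: mseq_tens; exact: mseq_base.
apply: (prodspan_lim (psi := psi)).
- exact: mseq_base.
- by move=> x xn; rewrite /base (negbTE xn).
- move=> N; apply: (prodspan_sum (phi := fun i =>
    tens 0 (cut 0 a N i) (cut 0 a N i.+1) (base (cut 0 a N i) n))) => i iN.
  have ca : cut 0 a N i.+1 <= a by rewrite -[leRHS](cut_last 0 a N) cut_le.
  by apply: (prodspan_le ca); apply: prodspan_tens => //; exact: IH.
apply: (@N2_bounded_cvg0 R nu M nuM _ (1 + 1) a n.+1).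
- by move=> N; apply: mseqB => //; exact: mseq_base.
- move=> N x xB; apply: (le_trans (ler_normB _ _)).
  by rewrite lerD ?psi_bound ?base_bound.
- move=> N [|p y] xB; first by rewrite psi_nil /base subrr.
  rewrite /tfirst /= => ap; rewrite psi_out ?(ltW ap)// /base /= /tfirst /=.
  by rewrite (le_gtF (ltW ap)) !andbF subrr.
- move=> N [|p y] xB //= ny; have ny' : (n < size y)%N by [].
  rewrite /base /= (gtn_eqF ny) /= subr0.
  have p0 : 0 <= p.1 by have := in_S_tfirst (inBox_S xB).
  have [pa|ap] := ltP p.1 a; last by rewrite psi_out.
  have [|i _ ->] := psi_in N p y; first by rewrite p0 pa.
  by rewrite /base (gtn_eqF ny').
move=> [|p y] xB xs.
  rewrite (_ : (fun _ => _) = cst 0); first exact: cvg_cst.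
  by apply/funext => N; rewrite psi_nil /base subrr.
have xS := inBox_S xB; have p0 : 0 <= p.1 by have := in_S_tfirst xS.
have yS : in_S y by move: xS; rewrite in_S_cons => /andP[].
have [pa|ap] := ltP p.1 a; last first.
  rewrite (_ : (fun _ => _) = cst 0); first exact: cvg_cst.
  apply/funext => N; rewrite psi_out// /base /= /tfirst /=.
  by rewrite (le_gtF ap) !andbF subrr.
apply: cvg_near_cst.
apply: filterS (eventually_below_cell a0 xs) => N below.
have [|i /andP[_ /below yi] ->] := psi_in N p y; first by rewrite p0 pa.
rewrite /base xS yS {2}/tfirst /= pa eqSS.
by rewrite (_ : nilp y = (y == [::])) ?yi ?subrr//; case: (y).
Qed.

(** Unlike [appr], the approximants need not be [good]: no further tensoring takes place, and
    general vectors need no time horizon. *)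
Definition reachable phi : Prop := mseq phi /\ forall eps : R, 0 < eps ->
  exists psi, [/\ reach nu psi, mseq psi & (N2 (fun x => (psi x - phi x)%R) < eps%:E)%E].

Lemma prodspan_reachable b n phi : prodspan b n phi -> reachable phi.
Proof.
move=> /(prodspan_appr nuM M0)[mphi aphi]; split=> // eps e0.
by have [psi [r g d]] := aphi _ e0; exists psi; split=> //; exact: good_mseq g.
Qed.

Lemma reachableD phi psi : reachable phi -> reachable psi ->
  reachable (fun x => phi x + psi x).
Proof.
move=> [m1 IH1] [m2 IH2]; split; first exact: mseqD.
move=> eps e0; have e8 : 0 < eps / 8 by rewrite divr_gt0.
have [p1 [r1 g1 d1]] := IH1 _ e8; have [p2 [r2 g2 d2]] := IH2 _ e8.
exists (fun x => p1 x + p2 x); split; [exact: reachD|exact: mseqD|].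
rewrite [X in N2 X](_ : _ = fun x => (p1 x - phi x) + (p2 x - psi x)); last first.
  by apply/funext => x; rewrite opprD addrACA.
apply: (le_lt_trans (N2D nu (mseqB g1 m1) (mseqB g2 m2))).
apply: (@le_lt_trans _ _ (2%:E * (eps / 8)%:E + 2%:E * (eps / 8)%:E)%E).
  by apply: leeD; apply: lee_wpmul2l => //; exact: ltW.
by rewrite -!EFinM -EFinD lte_fin; lra.
Qed.

Lemma reachableN phi : reachable phi -> reachable (fun x => - phi x).
Proof.
move=> [m1 IH1].
have mN psi : mseq psi -> mseq (fun x => - psi x).
  by move=> mpsi; under [X in mseq X]eq_fun do rewrite -mulN1r; exact: mseqZ.
split; first exact: mN.
move=> eps e0; have [p1 [r1 g1 d1]] := IH1 _ e0.
exists (fun x => - p1 x); split; [|exact: mN|].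
  by under [X in reach _ X]eq_fun do rewrite -mulN1r; exact: reachZ.
rewrite [X in N2 X](_ : _ = fun x => phi x - p1 x); first by rewrite N2_sub.
by apply/funext => x; rewrite opprK addrC.
Qed.

Lemma reachable_lim (g : nat -> seq (R * R) -> R) phi : mseq phi ->
  (forall N, reachable (g N)) ->
  (N2 (fun x => (g N x - phi x)%R) @[N --> \oo] --> 0)%E -> reachable phi.
Proof.
move=> mphi hg cv; split=> // eps e0.
have e8 : 0 < eps / 8 by rewrite divr_gt0.
have [N dN] := ecvg0_lt cv e8.
have [mN IHN] := hg N; have [p [r mp d]] := IHN _ e8.
exists p; split=> //.
apply: (le_lt_trans (N2_triangle nu mp mN mphi)).
apply: (@le_lt_trans _ _ (2%:E * (eps / 8)%:E + 2%:E * (eps / 8)%:E)%E).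
  by apply: leeD; apply: lee_wpmul2l => //; exact: ltW.
by rewrite -!EFinM -EFinD lte_fin; lra.
Qed.

Import HBNNSimple.

Lemma multiplier_lift_finite n (f : n.-tuple (R * R) -> R) (s : seq R) :
  measurable_fun setT f -> uniq s -> (forall t, f t \in s) -> multiplier n (lift f).
Proof.
move=> mf us fs.
pose m i x : R := s`_i * lift (\1_(f @^-1` [set s`_i]) : n.-tuple (R * R) -> R) x.
apply: (@multiplier_ext n (fun x => \sum_(i < size s) m i x)).
  move=> t; have ts : (index (f t) s < size s)%N by rewrite index_mem.
  rewrite lift_tuple (bigD1 (Ordinal ts))//= big1 ?addr0 /m => [|i it].
    by rewrite lift_tuple indicE nth_index// mem_set ?mulr1.
  rewrite lift_tuple indicE memNset ?mulr0//= => fti.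
  move/negP: it; apply; apply/eqP/val_inj => /=.
  by rewrite fti index_uniq.
apply: multiplier_sum => i _; apply: multiplierZ.
suff /measurable_multset[] : measurable (f @^-1` [set s`_i]) by [].
by rewrite -[X in measurable X]setTI; exact: mf.
Qed.

(** Increasing simple functions are multipliers; applied to the [base] with a growing time horizon
    they stay between 0 and [f] and converge to [f] on $S_n$, so [f] dominates. *)
Lemma reachable_lift_ge0 n (f : n.-tuple (R * R) -> R) : measurable_fun setT f ->
  (forall t, 0 <= f t) -> (N2 (lift f) < +oo)%E -> reachable (lift f).
Proof.
move=> mf f0 fin.
have mEf : measurable_fun setT (EFin \o f) by exact/measurable_EFinP.
pose g := nnsfun_approx measurableT mEf.
have Ef0 t : setT t -> (0 <= (EFin \o f) t)%E by rewrite lee_fin.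
have gf N t : 0 <= g N t <= f t.
  apply/andP; split; first exact: fun_ge0.
  by rewrite -lee_fin /g nnsfun_approxE; exact: le_approx.
have gcv t : g N t @[N --> \oo] --> f t.
  have := cvg_nnsfun_approx measurableT mEf Ef0 (x := t) I.
  by move=> /fine_cvgP[_].
have mg N : multiplier n (lift (g N)).
  have /finite_seqP[s rs] : finite_set (range (g N)) by exact: fimfunP.
  apply: (@multiplier_lift_finite n (g N) (undup s)) => [||t].
  - exact: measurable_funP.
  - exact: undup_uniq.
  - have : range (g N) (g N t) by exists t.
    by rewrite rs mem_undup.
have mgf N : mseq (lift (g N)) by apply: mseq_lift; exact: measurable_funP.
pose h N x := lift (g N) x * base N%:R n x.
apply: (@reachable_lim h).
- exact: mseq_lift.
- move=> N; apply: (@prodspan_reachable N%:R n); apply: mg; exact: prodspan_base.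
apply: (N2_dominated_cvg0 nuM (G := lift f) (n0 := n)) => //.
- by move=> N; apply: mseqB; [apply: mseqM => //; exact: mseq_base|exact: mseq_lift].
- exact: mseq_lift.
- move=> N x xB; rewrite /h; have [/size_tupleP[t ->]|xn] := eqVneq (size x) n; last first.
    by rewrite !lift_size// mul0r subr0.
  rewrite !lift_tuple distrC; have /andP[g0 gt] := gf N t.
  rewrite /base; case: [&& _, _ & _]; rewrite ?mulr1 ?mulr0 ?subr0//.
  by rewrite !ger0_norm ?f0 ?subr_ge0// gerBl.
- move=> x xB _; rewrite /h; have [xn|xn] := eqVneq (size x) n; last first.
    rewrite (_ : (fun _ => _) = cst 0); first exact: cvg_cst.
    by apply/funext => N; rewrite !lift_size// mul0r subr0.
  have [t xt] := size_tupleP xn; rewrite xt !lift_tuple.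
  rewrite (_ : 0 = f t * 1 - f t); last by rewrite mulr1 subrr.
  apply: cvgB; last exact: cvg_cst.
  under eq_cvg do rewrite lift_tuple.
  apply: cvgM; first exact: gcv.
  apply: cvg_near_cst; near=> N.
  rewrite /base -xt xn eqxx (inBox_S xB) /= (_ : _ < _ = true) ?orbT//.
  by near: N; exact: nbhs_infty_gtr.
- move=> N x _ nx; rewrite /h !lift_size ?mul0r ?subrr// gtn_eqF//.
Unshelve. all: by end_near. Qed.

Lemma reachable_lift n (f : n.-tuple (R * R) -> R) : measurable_fun setT f ->
  (N2 (lift f) < +oo)%E -> reachable (lift f).
Proof.
move=> mf fin.
pose fp t := Num.max (f t) 0; pose fn t := Num.max (- f t) 0.
have mfp : measurable_fun setT fp by exact: measurable_maxr.
have mfn : measurable_fun setT fn.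
  by apply: measurable_maxr => //; exact: measurableT_comp.
have lt1 (f' : n.-tuple (R * R) -> R) : measurable_fun setT f' ->
    (forall t, `|f' t| <= `|f t|) -> (N2 (lift f') < +oo)%E.
  move=> mf' f'f; apply: le_lt_trans fin; rewrite -[leRHS]mul1e -(expr1n _ 2).
  apply: (le_N2 nuM); [exact: mseq_lift|exact: mseq_lift|] => x _; rewrite mul1r.
  by rewrite /lift; case: insub => [t|]; rewrite ?normr0.
rewrite (_ : lift f = fun x => lift fp x + - lift fn x); last first.
  apply/funext => x; rewrite /lift; case: insub => [t|]; last by rewrite subr0.
  rewrite /fp /fn; case: (leP 0 (f t)) => ft.
    by rewrite (max_idPr _) ?oppr_le0// subr0.
  by rewrite (max_idPl _) ?oppr_ge0 ?(ltW ft)// opprK add0r.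
apply: reachableD; [|apply: reachableN]; apply: reachable_lift_ge0 => //.
- by move=> t; rewrite le_max lexx orbT.
- apply: lt1 => // t; rewrite /fp; case: (leP 0 (f t)) => // _.
  by rewrite normr0.
- by move=> t; rewrite le_max lexx orbT.
- apply: lt1 => // t; rewrite /fn; case: (leP 0 (- f t)) => // _.
    by rewrite normrN.
  by rewrite normr0.
Qed.

(** Truncate the particle number: each truncation is a finite sum of lifted components, and the
    error is a tail of the convergent series of squared norms. *)
Lemma reachable_Fock (F : fvec R) : in_Fock nu F -> reachable (seq_of F).
Proof.
move=> [mF F2]; pose phi := seq_of F.
have phiE n (x : n.-tuple (R * R)) : phi x = F n x.
  by have := congr1 (fun G : fvec R => G n x) (fvec_ofK F).
have mphi : mseq phi.
  move=> n; rewrite (_ : (fun _ => _) = F n); first exact: mF.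
  by apply/funext => x; rewrite phiE.
have N2phi : (N2 phi < +oo)%E.
  apply: le_lt_trans F2; rewrite le_eqVlt; apply/orP; left; apply/eqP.
  apply: eq_eseriesr => n _; congr (norm2 nu _).
  by apply/funext => x; rewrite phiE.
pose g k x := (size x < k)%N%:R * phi x.
have mg k : mseq (g k).
  apply: mseqM => // n; rewrite (_ : (fun _ => _) = cst ((n < k)%N%:R : R)).
    exact: measurable_cst.
  by apply/funext => x; rewrite size_tuple.
apply: (@reachable_lim g) => //.
  elim=> [|k IH].
    rewrite (_ : g 0%N = fun x => 0 * @vac R x); last first.
      by apply/funext => x; rewrite /g ltn0 !mul0r.
    by apply: (@prodspan_reachable 0 0); apply: prodspan_scale; exact: prodspan_vac.
  have liftE x : lift (F k) x = (size x == k)%:R * phi x.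
    have [/size_tupleP[t ->]|xk] := eqVneq (size x) k.
      by rewrite lift_tuple phiE mul1r.
    by rewrite lift_size// mul0r.
  rewrite (_ : g k.+1 = fun x => g k x + lift (F k) x); last first.
    apply/funext => x; rewrite liftE /g -mulrDl; congr (_ * _).
    by rewrite ltnS leq_eqVlt; case: ltngtP; rewrite /= ?addr0 ?add0r.
  apply: reachableD => //; apply: reachable_lift; first exact: mF.
  apply: le_lt_trans N2phi; rewrite -[leRHS]mul1e -(expr1n _ 2).
  apply: (le_N2 nuM) => //; first by apply: mseq_lift; exact: mF.
  move=> x _; rewrite liftE mul1r; case: (_ == _); rewrite ?mul1r//.
  by rewrite mul0r normr0.
have tail := nneseries_tail_cvg N2phi (fun k _ => @norm2_ge0 R nu k _).
apply: (@squeeze_cvge _ _ _ _ (fun=> 0%E) _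
   (fun k => \sum_(k <= n <oo) norm2 nu (fun x : n.-tuple (R * R) => phi x))%E) => //.
  apply: nearW => k; rewrite N2_ge0 /=.
  change (\sum_(n <oo) norm2 nu (fun x : n.-tuple (R * R) => (g k x - phi x)%R) <=
    \sum_(k <= n <oo) norm2 nu (fun x : n.-tuple (R * R) => phi x))%E.
  rewrite (nneseries_split 0 k); last by move=> i _; exact: norm2_ge0.
  rewrite add0n big1_seq ?add0e; last first.
    move=> i /andP[_]; rewrite mem_index_iota => /andP[_ ik].
    apply: (@norm2_eq0 R nu i (fun x => g k x - phi x)) => x xi _.
    by rewrite /g xi ik mul1r subrr.
  apply: lee_nneseries => [i _ _|i _]; first exact: norm2_ge0.
  rewrite /norm2; apply: le_iint_ae.
  - exact: (@measurable_norm2_integrand R i (fun x => g k x - phi x) (mseqB (mg k) mphi)).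
  - exact: measurable_norm2_integrand.
  - by move=> x; exact: norm2_integrand_ge0.
  - by move=> x; exact: norm2_integrand_ge0.
  apply: iaeW => x; rewrite lee_fin ler_wpM2l// /g.
  case: (_ < _)%N; first by rewrite mul1r subrr expr0n sqr_ge0.
  by rewrite mul0r sub0r sqrrN.
exact: cvg_cst.
Qed.

End Density.

Theorem theorem3p1 (R : realType) (nu : probability R R) :
  compact_support nu ->
  forall F : fvec R, in_Fock nu F ->
  forall eps : R, 0 < eps ->
  exists P : fvec R -> fvec R,
    inA nu P /\ (dist2 nu (P (@vacuum R)) F < eps%:E)%E.
Proof.
(* The given bound on the support may be negative, whereas the estimates use a nonnegative one. *)
move=> [M nuM] F FF eps e0; pose M' := Num.max M 0.
have M'0 : 0 <= M' by rewrite le_max lexx orbT.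
have measM (c : R) : measurable [set s : R | c < `|s|].
  rewrite [X in measurable X](_ : _ = (fun s : R => `|s|) @^-1` `]c, +oo[).
    rewrite -[X in measurable X]setTI.
    exact: (@normr_measurable R setT measurableT _ (measurable_itv _)).
  by apply/seteqP; split => s /=; rewrite in_itv/= andbT.
have nuM' : nu [set s | M' < `|s|] = 0%E.
  apply: (subset_measure0 (measM M') (measM M) _ nuM) => s /=.
  by rewrite /M' gt_max => /andP[].
have [_ /(_ eps e0)[psi [[P [AP Pv]] _ d]]] := reachable_Fock nuM' M'0 FF.
exists P; split=> //; rewrite Pv -(fvec_ofK F); exact: d.
Qed.
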